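(* Let $(Z,\rho_0)$ be an antipodal space. Then the Moebius space $\mathcal{M}(Z)$ is a maximal Gromov product space which is a filling of $Z$; that is, $\mathcal{M}(Z)$ is a Gromov product space, there is a Moebius homeomorphism $\partial_P\mathcal{M}(Z)\to Z$, and $\mathcal{M}(Z)$ is maximal as a Gromov product space.
   Context: Antipodal spaces and Moebius spaces. Let $Z$ be a compact metrizable space containing at least four points. A separating function on $Z$ is a continuous function $\rho : Z\times Z\to[0,\infty)$ which is symmetric and satisfies $\rho(\xi,\eta)=0$ if and only if $\xi=\eta$. Its cross-ratio is defined on quadruples of distinct points of $Z$ by $[\xi,\xi',\eta,\eta']_\rho=\frac{\rho(\xi,\eta)\rho(\xi',\eta')}{\rho(\xi,\eta')\rho(\xi',\eta)}$. Two separating functions are Moebius equivalent if their cross-ratios agree. If $\rho_1,\rho_2$ are Moebius equivalent, there is a unique positive continuous function $\frac{d\rho_2}{d\rho_1}:Z\to(0,\infty)$, the derivative, such that $\rho_2(\xi,\eta)^2=\frac{d\rho_2}{d\rho_1}(\xi)\frac{d\rho_2}{d\rho_1}(\eta)\rho_1(\xi,\eta)^2$ for all $\xi,\eta\in Z$. An antipodal function on $Z$ is a separating function $\rho$ such that $\sup_{\xi,\eta}\rho(\xi,\eta)=1$ and for every $\xi\in Z$ there is $\eta\in Z$ with $\rho(\xi,\eta)=1$. An antipodal space $(Z,\rho_0)$ is such a space $Z$ equipped with an antipodal function $\rho_0$. Its Moebius space $\mathcal{M}(Z)=\mathcal{M}(Z,\rho_0)$ is the set of all antipodal functions on $Z$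 Moebius equivalent to $\rho_0$, with the metric $d_{\mathcal{M}}(\rho_1,\rho_2)=\left\|\log\frac{d\rho_2}{d\rho_1}\right\|_\infty$. A map between antipodal spaces is Moebius if it preserves cross-ratios of all quadruples of distinct points. Gromov product spaces. A metric space is proper if closed balls are compact, and geodesically complete if every geodesic segment extends to a bi-infinite geodesic. $(y|z)_x=\frac12(d(x,y)+d(x,z)-d(y,z))$. A proper, geodesic, geodesically complete metric space $X$ is a Gromov product space if there is a second countable Hausdorff compactification $\widehat X$ of $X$ such that for every $x\in X$ the Gromov product $(\cdot|\cdot)_x:X\times X\to[0,+\infty)$ extends to a continuous function $\widehat X\times\widehat X\to[0,+\infty]$ such that for $\xi,\eta\in\widehat X\setminus X$, $(\xi|\eta)_x=+\infty$ if and only if $\xi=\eta$. Such a compactification is unique up to equivalence; it is denoted $\widehat X^P$, and $\partial_PX:=\widehat X^P\setminus X$ is the Gromov product boundary. For $x\in X$ set $\rho_x=e^{-(\cdot|\cdot)_x}$ on $\partial_PX\times\partial_PX$. When $\partial_PX$ has at least four points (as is assumed throughout), the $\rho_x$ are antipodal functions on $\partial_PX$, all Moebius equivalent, and $\partial_PX$ is regarded as an antipodal space with any of them. A filling of an antipodal space $Z$ is a Gromov product space $X$ with a Moebius homeomorphism $\partial_PX\to Z$. A Gromov product space $X$ is maximal if for every Gromov product space $Y$ and Moebius homeomorphism $f:\partial_PY\to\partial_PX$, there is an isometric (distance-preserving) embedding $F:Y\to X$ extending $f$, i.e. such that $F\cup f:\widehat Y^P\to\widehat X^P$ is continuous. 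*)

(* Defs.v *)
From HB Require Import structures.
From mathcomp Require Import all_boot all_order all_algebra.
From mathcomp Require Import all_classical all_reals all_analysis.
From mathcomp Require Import ring lra.

Set Implicit Arguments.
Unset Strict Implicit.
Unset Printing Implicit Defensive.

Import Order.TTheory GRing.Theory Num.Theory.
Import numFieldNormedType.Exports.

Local Open Scope classical_set_scope.
Local Open Scope ring_scope.

Definition homeomorphism (T U : topologicalType) (f : T -> U) : Prop :=
  continuous f /\ exists g : U -> T, [/\ continuous g, cancel f g & cancel g f].

Definition metrizable (R : realType) (T : topologicalType) : Prop :=
  exists (M : metricType R) (f : T -> M), homeomorphism f.

Definition at_least_four_points (T : eqType) : Prop :=
  exists a b c d : T, uniq [:: a; b; c; d].

Definition cross_ratio (R : realType) (T : Type) (rho : T -> T -> R)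
    (xi xi' eta eta' : T) : R :=
  (rho xi eta * rho xi' eta') / (rho xi eta' * rho xi' eta).

Definition moebius_map (R : realType) (T U : eqType)
    (rhoT : T -> T -> R) (rhoU : U -> U -> R) (f : T -> U) : Prop :=
  forall xi xi' eta eta' : T, uniq [:: xi; xi'; eta; eta'] ->
    cross_ratio rhoU (f xi) (f xi') (f eta) (f eta') =
    cross_ratio rhoT xi xi' eta eta'.

Section AntipodalFunctions.
Context {R : realType} {Z : topologicalType}.
Implicit Types rho : Z -> Z -> R.

Definition separating rho : Prop :=
  [/\ continuous (fun p : Z * Z => rho p.1 p.2),
      forall xi eta, 0 <= rho xi eta,
      forall xi eta, rho xi eta = rho eta xi &
      forall xi eta, rho xi eta = 0 <-> xi = eta].

Definition moebius_equivalent rho1 rho2 : Prop :=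
  forall xi xi' eta eta' : Z, uniq [:: xi; xi'; eta; eta'] ->
    cross_ratio rho1 xi xi' eta eta' = cross_ratio rho2 xi xi' eta eta'.

(* [sup] is 0 on sets without a least upper bound, so [sup A = 1] does entail
   that [A] is bounded with least upper bound 1. *)
Definition antipodal rho : Prop :=
  [/\ separating rho,
      sup (range (fun p : Z * Z => rho p.1 p.2)) = 1 &
      forall xi, exists eta, rho xi eta = 1].

Definition is_derivative rho1 rho2 (g : Z -> R) : Prop :=
  [/\ continuous g,
      forall xi, 0 < g xi &
      forall xi eta, rho2 xi eta ^+ 2 = g xi * g eta * rho1 xi eta ^+ 2].

(* d rho2 / d rho1: see [derivativeP] and [derivative_unique] below. *)
Definition derivative rho1 rho2 : Z -> R := get (is_derivative rho1 rho2).

Definition dist_moebius rho1 rho2 : R :=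
  sup (range (fun xi => `|ln (derivative rho1 rho2 xi)|)).

End AntipodalFunctions.

Record antipodalSpace (R : realType) := AntipodalSpace {
  apt_space :> topologicalType;
  apt_compact : compact [set: apt_space];
  apt_metrizable : metrizable R apt_space;
  apt_four : at_least_four_points apt_space;
  apt_fun : apt_space -> apt_space -> R;
  apt_funP : antipodal apt_fun }.

Record moebius_space (R : realType) (Z : antipodalSpace R) := MoebiusPoint {
  mpt_fun :> Z -> Z -> R;
  mpt_antipodal : antipodal mpt_fun;
  mpt_equivalent : moebius_equivalent (apt_fun (a := Z)) mpt_fun }.

Section DerivativeTheory.
Context {R : realType} {Z : topologicalType}.
Hypothesis Z4 : at_least_four_points Z.
Implicit Types rho : Z -> Z -> R.

Lemma four_points_avoid2 (x y : Z) : exists z : Z, z != x /\ z != y.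
Proof.
have [a [b [c [d]]]] := Z4; rewrite /= !inE !negb_or.
move=> /and4P[/and3P[ab ac ad] /andP[bc bd] cd _].
case: (eqVneq a x) => [ax|ax]; case: (eqVneq a y) => [ay|ay].
- by exists b; rewrite -ax -ay eq_sym ab.
- subst x; case: (eqVneq b y) => [<-|yb].
    by exists c; rewrite eq_sym ac eq_sym bc.
  by exists b; rewrite yb eq_sym ab.
- subst y; case: (eqVneq b x) => [<-|yb].
    by exists c; rewrite eq_sym bc eq_sym ac.
  by exists b; rewrite yb eq_sym ab.
- by exists a.
Qed.

Lemma derivative_unique rho1 rho2 g h : separating rho1 ->
  is_derivative rho1 rho2 g -> is_derivative rho1 rho2 h -> g = h.
Proof.
move=> [_ _ _ s0] [_ gp gE] [_ hp hE]; apply/funext => x.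
have [y [yx _]] := four_points_avoid2 x x.
have [z [zx zy]] := four_points_avoid2 x y.
have key a b : a != b -> g a * g b = h a * h b.
  move=> ab; have r0 : rho1 a b ^+ 2 != 0.
    by rewrite expf_neq0//; apply: contra_neq ab => /s0.
  by apply: (mulIf r0); rewrite -gE -hE.
have exy : g x * g y = h x * h y by apply: key; rewrite eq_sym.
have exz : g x * g z = h x * h z by apply: key; rewrite eq_sym.
have eyz : g y * g z = h y * h z by apply: key; rewrite eq_sym.
have sq : g x ^+ 2 = h x ^+ 2.
  have n0 : h y * h z != 0 by rewrite mulf_neq0// gt_eqF.
  apply: (mulIf n0); rewrite -{1}eyz.
  transitivity ((g x * g y) * (g x * g z)); first by ring.
  by rewrite exy exz; ring.
by apply: (pexpIrn (n := 2)) => //; rewrite nnegrE ltW.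
Qed.

Section Existence.
Variables rho1 rho2 : Z -> Z -> R.
Hypothesis s1 : separating rho1.
Hypothesis s2 : separating rho2.
Hypothesis me : moebius_equivalent rho1 rho2.

Let r a b := rho2 a b / rho1 a b.

Let sep_gt0 rho : separating rho -> forall a b, a != b -> 0 < rho a b.
Proof.
move=> [_ ge0 _ s0] a b ab; rewrite lt_neqAle ge0 andbT eq_sym.
by apply: contra_neq ab => /s0.
Qed.

Let r_gt0 a b : a != b -> 0 < r a b.
Proof. by move=> ab; rewrite divr_gt0// sep_gt0. Qed.

Let r_sym a b : r a b = r b a.
Proof. by have [_ _ c1 _] := s1; have [_ _ c2 _] := s2; rewrite /r c1 c2. Qed.

Let r_cross a b c d : uniq [:: a; b; c; d] -> r a c * r b d = r a d * r b c.
Proof.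
move=> u; have := me u; move: u; rewrite /= !inE !negb_or /cross_ratio /r.
move=> /and4P[/and3P[ab ac ad] /andP[bc bd] cd _].
have := sep_gt0 s1 ac; have := sep_gt0 s1 ad; have := sep_gt0 s1 bc.
have := sep_gt0 s1 bd; have := sep_gt0 s2 ac; have := sep_gt0 s2 ad.
have := sep_gt0 s2 bc; have := sep_gt0 s2 bd.
move: (rho1 a c) (rho1 b d) (rho1 a d) (rho1 b c) => p1 p2 p3 p4.
move: (rho2 a c) (rho2 b d) (rho2 a d) (rho2 b c) => q1 q2 q3 q4.
move=> q2p q4p q3p q1p p2p p4p p3p p1p.
have n12 : p1 * p2 != 0 by rewrite mulf_neq0 ?gt_eqF.
have n34 : p3 * p4 != 0 by rewrite mulf_neq0 ?gt_eqF.
have m34 : q3 * q4 != 0 by rewrite mulf_neq0 ?gt_eqF.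
move=> /eqP; rewrite (eqr_div _ _ n34 m34) => /eqP E.
by rewrite !mulf_div; apply/eqP; rewrite (eqr_div _ _ n12 n34) -E mulrC.
Qed.

Let G a b c := r a b * r a c / r b c.

Let GC a b c : G a b c = G a c b.
Proof. by rewrite /G [r a b * _]mulrC [r b c]r_sym. Qed.

Let G_change a b c d : a != b -> a != c -> a != d -> b != c -> b != d ->
  G a b c = G a b d.
Proof.
move=> ab ac ad bc bd; have [->//|cd] := eqVneq c d.
have := @r_cross a b c d; rewrite /= !inE !negb_or ab ac ad bc bd cd => /(_ isT).
have nbc : r b c != 0 by rewrite gt_eqF ?r_gt0.
have nbd : r b d != 0 by rewrite gt_eqF ?r_gt0.
move=> E; apply/eqP; rewrite /G (eqr_div _ _ nbc nbd); apply/eqP.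
by rewrite -[LHS]mulrA E mulrA.
Qed.

Let G_indep a b c b' c' : a != b -> a != c -> b != c ->
  a != b' -> a != c' -> b' != c' -> G a b c = G a b' c'.
Proof.
move=> ab ac bc ab' ac' bc'.
have [bc''|bc''] := eqVneq b c'.
  by subst c'; rewrite [RHS]GC; apply: G_change => //; rewrite eq_sym.
rewrite (@G_change a b c c')// GC [RHS]GC.
by apply: G_change => //; rewrite eq_sym.
Qed.

Let pick2 a : {bc : Z * Z | [/\ a != bc.1, a != bc.2 & bc.1 != bc.2]}.
Proof.
apply: cid; have [b [ba _]] := four_points_avoid2 a a.
have [c [ca cb]] := four_points_avoid2 a b.
by exists (b, c); rewrite /= eq_sym ba eq_sym ca eq_sym cb.
Qed.

Let g a := let bc := sval (pick2 a) in G a bc.1 bc.2.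

Let gE a b c : a != b -> a != c -> b != c -> g a = G a b c.
Proof.
by move=> ab ac bc; rewrite /g; case: pick2 => -[b' c'] /= [? ? ?]; exact: G_indep.
Qed.

Let cont1 rho b : separating rho -> continuous (rho ^~ b).
Proof.
move=> [cr _ _ _] x.
apply: (@continuous_comp _ _ _ (fun a => (a, b)) (fun p => rho p.1 p.2)).
  by apply: cvg_pair; [exact: cvg_id | exact: cvg_cst].
exact: cr.
Qed.

Let near_neq (x b : Z) : x != b -> \forall y \near x, y != b.
Proof.
move=> xb; have /(_ x) cr := @cont1 _ b s1.
have /cr : nbhs (rho1 x b) [set t : R | 0 < t].
  by apply: lt_nbhsr; exact: sep_gt0.
rewrite /= => h; near=> y; apply/eqP => yb.
have : 0 < rho1 y b by near: y; exact: h.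
by have [_ _ _ s0] := s1; rewrite (s0 y b).2// ltxx.
Unshelve. all: by end_near. Qed.

Lemma derivative_exists : exists g, is_derivative rho1 rho2 g.
Proof.
exists g; split.
- move=> x; have [[b c] /= [xb xc bc]] := pick2 x.
  have E : \forall y \near x, G y b c = g y.
    near=> y; apply/esym/gE => //; near: y; exact: near_neq.
  rewrite /continuous_at (gE xb xc bc).
  apply: cvg_trans (near_eq_cvg E) _.
  rewrite /G /r.
  by apply: cvgM; [apply: cvgM; apply: cvgM;
    [exact: cont1 | apply: cvgV; [rewrite gt_eqF// sep_gt0|exact: cont1] |
     exact: cont1 | apply: cvgV; [rewrite gt_eqF// sep_gt0|exact: cont1]] |
    exact: cvg_cst].
- move=> x; have [[b c] /= [xb xc bc]] := pick2 x.
  by rewrite (gE xb xc bc); apply: divr_gt0; [apply: mulr_gt0|]; exact: r_gt0.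
- move=> a b; have [<-|ab] := eqVneq a b.
    have [_ _ _ s10] := s1; have [_ _ _ s20] := s2.
    by rewrite (s10 a a).2// (s20 a a).2// expr0n/= mulr0.
  have [c [ca cb]] := four_points_avoid2 a b.
  rewrite eq_sym in ca; rewrite eq_sym in cb.
  have ba : b != a by rewrite eq_sym.
  rewrite (gE ab ca cb) (gE ba cb ca) /G (r_sym b a).
  have := r_gt0 ab; have := r_gt0 ca; have := r_gt0 cb.
  have -> : rho2 a b = r a b * rho1 a b by rewrite /r divfK// gt_eqF// sep_gt0.
  by move: (r a b) (r a c) (r b c) => u v w w0 v0 u0; field; rewrite !gt_eqF.
Unshelve. all: by end_near. Qed.

Lemma derivativeP : is_derivative rho1 rho2 (derivative rho1 rho2).
Proof. by have [h ?] := derivative_exists; exact: (getPex (ex_intro _ h _)). Qed.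

End Existence.

End DerivativeTheory.

Section MoebiusMetric.
Context {R : realType} {Z : antipodalSpace R}.
Local Notation MZ := (moebius_space Z).
Implicit Types x y z : MZ.

Lemma mpt_sep x : separating x.
Proof. by have [] := mpt_antipodal x. Qed.

Lemma mpt_me x y : moebius_equivalent x y.
Proof. by move=> a b c d u; rewrite -!mpt_equivalent. Qed.

Local Notation D := (@derivative R Z).

Lemma mpt_derivativeP x y : is_derivative x y (D x y).
Proof.
by apply: derivativeP; [exact: apt_four|exact: mpt_sep..|exact: mpt_me].
Qed.

Let D_gt0 x y xi : 0 < D x y xi.
Proof. by have [] := mpt_derivativeP x y. Qed.

Let D_uniq x y g : is_derivative x y g -> g = D x y.
Proof.
move=> h.
exact: (derivative_unique (@apt_four _ Z) (@mpt_sep x) h (mpt_derivativeP x y)).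
Qed.

Let Dxx x : D x x = cst 1.
Proof.
by apply/esym/D_uniq; split => [a|//|a b]; [exact: cvg_cst|rewrite /cst !mul1r].
Qed.

Let Dinv x y : D y x = fun xi => (D x y xi)^-1.
Proof.
have [cD _ DE] := mpt_derivativeP x y.
apply/esym/D_uniq; split => [a|a|a b].
- by apply: cvgV; [rewrite gt_eqF|exact: cD].
- by rewrite invr_gt0.
- rewrite DE; move: (D_gt0 x y a) (D_gt0 x y b).
  by move: (D x y a) (D x y b) => u v u0 v0; field; rewrite !gt_eqF.
Qed.

Let Dchain x y z : D x z = fun xi => D x y xi * D y z xi.
Proof.
have [c1 _ E1] := mpt_derivativeP x y; have [c2 _ E2] := mpt_derivativeP y z.
apply/esym/D_uniq; split => [a|a|a b].
- by apply: cvgM; [exact: c1|exact: c2].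
- by rewrite mulr_gt0.
- by rewrite E2 E1; ring.
Qed.

Local Notation S x y := (range (fun xi => `|ln (D x y xi)|)).

Let S_ub x y : has_ubound (S x y).
Proof.
have [cD _ _] := mpt_derivativeP x y.
have cf : continuous (fun xi => `|ln (D x y xi)|).
  move=> a; apply: cvg_norm.
  by apply: continuous_cvg; [exact: continuous_ln|exact: cD].
have : compact (S x y).
  apply: continuous_compact (@apt_compact _ Z).
  exact: continuous_subspaceT.
move=> /compact_bounded[M [_ /(_ (M + 1))]].
rewrite ltrDl ltr01 => /(_ isT) hM; exists (M + 1) => y' /hM /=.
exact: le_trans (ler_norm _).
Qed.

Let S_le x y xi : `|ln (D x y xi)| <= dist_moebius x y.
Proof. by apply: ub_le_sup; [exact: S_ub|exists xi]. Qed.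

Let S_sup x y (m : R) : (forall xi, `|ln (D x y xi)| <= m) -> dist_moebius x y <= m.
Proof.
move=> h; apply: ge_sup; last by move=> _ [a _ <-].
by have [a _] := @apt_four _ Z; exists `|ln (D x y a)|; exists a.
Qed.

Lemma dist_moebiusxx x : dist_moebius x x = 0.
Proof.
have [a _] := @apt_four _ Z.
apply/le_anti/andP; split; last by exact: le_trans (S_le x x a).
by apply: S_sup => xi; rewrite Dxx /cst ln1 normr0.
Qed.

Lemma dist_moebius_positivity x y : dist_moebius x y = 0 -> x = y.
Proof.
move=> d0.
have D1 xi : D x y xi = 1.
  apply: ln_inj; rewrite ?posrE// ln1; apply/normr0_eq0/le_anti/andP.
  by split=> //; rewrite -d0.
have [_ _ DE] := mpt_derivativeP x y.
have xy : mpt_fun x = mpt_fun y.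
  apply/funext => a; apply/funext => b; apply/esym.
  have [_ ge0x _ _] := mpt_sep x; have [_ ge0y _ _] := mpt_sep y.
  by apply: (pexpIrn (n := 2)); rewrite ?nnegrE // DE !D1 !mul1r.
case: x y xy {d0 D1 DE} => [f p q] [f' p' q'] /= E; subst f'.
by congr MoebiusPoint; exact: Prop_irrelevance.
Qed.

Lemma dist_moebius_sym x y : dist_moebius x y = dist_moebius y x.
Proof.
rewrite /dist_moebius (Dinv y x); congr sup; apply: eq_imagel => xi _.
by rewrite lnV ?posrE// normrN.
Qed.

Lemma dist_moebius_triangle y x z :
  dist_moebius x z <= dist_moebius x y + dist_moebius y z.
Proof.
apply: S_sup => xi; rewrite (Dchain x y z) lnM ?posrE//.
by rewrite (le_trans (ler_normD _ _))// lerD.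
Qed.

End MoebiusMetric.

HB.instance Definition _ (R : realType) (Z : antipodalSpace R) :=
  gen_eqMixin (moebius_space Z).
HB.instance Definition _ (R : realType) (Z : antipodalSpace R) :=
  gen_choiceMixin (moebius_space Z).
HB.instance Definition _ (R : realType) (Z : antipodalSpace R) :=
  isMetric.Build R (moebius_space Z) (@dist_moebiusxx R Z)
    (@dist_moebius_positivity R Z) (@dist_moebius_sym R Z)
    (@dist_moebius_triangle R Z).

Section MetricNotions.
Context {R : realType}.

Definition gromov_product (X : metricType R) (x y z : X) : R :=
  (mdist x y + mdist x z - mdist y z) / 2.

Definition proper_space (X : metricType R) : Prop :=
  forall (x : X) (r : R), compact [set y | mdist x y <= r].

Definition geodesic_on (X : metricType R) (A : set R) (c : R -> X) : Prop :=
  forall s t, A s -> A t -> mdist (c s) (c t) = `|s - t|.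

Definition geodesic (X : metricType R) : Prop :=
  forall x y : X, exists c : R -> X,
    [/\ geodesic_on `[0, mdist x y] c, c 0 = x & c (mdist x y) = y].

Definition geodesically_complete (X : metricType R) : Prop :=
  forall (a b : R) (c : R -> X), a <= b -> geodesic_on `[a, b] c ->
    exists c' : R -> X, geodesic_on setT c' /\ {in `[a, b], c' =1 c}.

Definition isometric_embedding (X Y : metricType R) (F : X -> Y) : Prop :=
  forall x x', mdist (F x) (F x') = mdist x x'.

End MetricNotions.

Record compactification (X : topologicalType) := Compactification {
  cpt_space :> topologicalType;
  cpt_emb : X -> cpt_space;
  cpt_compact : compact [set: cpt_space];
  cpt_hausdorff : hausdorff_space cpt_space;
  cpt_inj : injective cpt_emb;
  (* with injectivity: [cpt_emb] is a homeomorphism onto its image *)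
  cpt_open : forall U : set X,
    open U <-> exists2 V, open V & U = cpt_emb @^-1` V;
  cpt_dense : dense (range cpt_emb) }.

Arguments cpt_emb {X} c _.

(* The complement of X in its compactification, with the induced topology
   once coerced to a type. *)
Definition boundary (X : topologicalType) (K : compactification X) : set K :=
  ~` range (cpt_emb K).

Arguments boundary {X} K _.

Section GromovProductSpaces.
Context {R : realType}.

Definition gromov_extension (X : metricType R) (K : compactification X)
    (x : X) (g : K * K -> \bar R) : Prop :=
  [/\ continuous g,
      forall p, (0 <= g p)%E &
      forall y z, g (cpt_emb K y, cpt_emb K z) = (gromov_product x y z)%:E].

Definition gp_compactification (X : metricType R) (K : compactification X) :
    Prop :=
  @second_countable K /\
  forall x : X, exists2 g, gromov_extension x g &
    forall xi eta : boundary K, g (\val xi, \val eta) = +oo%E <-> xi = eta.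

(* The extension is unique, as the image of X * X is dense in K * K. *)
Definition boundary_product (X : metricType R) (K : compactification X)
    (x : X) : K * K -> \bar R := get (gromov_extension x).

(* exp (- (xi | eta)_x) with exp (- oo) = 0 *)
Definition boundary_rho (X : metricType R) (K : compactification X)
    (x : X) (xi eta : boundary K) : R :=
  fine (expeR (- boundary_product x (\val xi, \val eta)))%E.

(* The standing assumption that the boundary has at least four points is made
   part of the definition. *)
Definition gromov_product_space (X : metricType R) : Prop :=
  [/\ proper_space X, geodesic X, geodesically_complete X &
      exists2 K : compactification X,
        gp_compactification K & at_least_four_points (boundary K)].

(* In [filling] and [maximal_gp_space], "the" compactification of a Gromov product
   space is unique up to equivalence, and the functions [boundary_rho x] all
   have the same cross-ratios: hence the universal quantifications over [K],
   [KX], [KY] and over base points. *)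
Definition filling (Z : antipodalSpace R) (X : metricType R) : Prop :=
  gromov_product_space X /\
  forall K : compactification X, gp_compactification K ->
    exists f : boundary K -> Z,
      homeomorphism f /\
      forall x : X, moebius_map (boundary_rho x) (apt_fun (a := Z)) f.

(* [h] below is the union of F and f. *)
Definition maximal_gp_space (X : metricType R) : Prop :=
  gromov_product_space X /\
  forall KX : compactification X, gp_compactification KX ->
  forall Y : metricType R, gromov_product_space Y ->
  forall KY : compactification Y, gp_compactification KY ->
  forall f : boundary KY -> boundary KX,
    homeomorphism f ->
    (forall (y : Y) (x : X),
      moebius_map (boundary_rho y) (boundary_rho x) f) ->
    exists2 F : Y -> X, isometric_embedding F &
      exists h : KY -> KX,
        [/\ continuous h,
            forall y, h (cpt_emb KY y) = cpt_emb KX (F y) &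
            forall xi : boundary KY, h (\val xi) = \val (f xi)].

End GromovProductSpaces.

(* Main.v *)
Require Import Defs.
From HB Require Import structures.
From mathcomp Require Import all_boot all_order all_algebra.
From mathcomp Require Import all_classical all_reals all_analysis.
From mathcomp Require Import ring lra.

Set Implicit Arguments.
Unset Strict Implicit.
Unset Printing Implicit Defensive.

Import Order.TTheory GRing.Theory Num.Theory.
Import numFieldNormedType.Exports.

Local Open Scope classical_set_scope.
Local Open Scope ring_scope.

(** The Moebius space is a tight span. Relative to a point [x] of the Moebius
    space [M], every point is [y a b = expR (h a + h b) * x a b], where [h] is
    half of the logarithm of the derivative, and [y] is antipodal exactly when
    [- h a = ln (sup_b expR (h b) * x a b)] for every [a]. So [- h] ranges over
    the minimal functions of the pseudo-distance [ln (x a b)], whose diagonal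
    is infinitely negative, and the metric of [M] is twice the supremum of
    differences of such functions: [M] is the injective hull of [Z] seen as a
    set of points at infinity. Two facts make this usable. Averaging a function
    with its dual and iterating gives a nonexpansive retraction [tighten] onto
    the minimal functions, and a bounded minimal function is automatically
    continuous ([mpt_of_tight]), so that discontinuous functions may be fed to
    the retraction.

    Retracting affine segments gives geodesics; retracting the functions equal
    to [t / 2] at [xi] and to [- t / 2] elsewhere gives a geodesic ray towards
    [xi] ([directed_ray]). The function [h] from [x] to [y] has opposite
    extrema, reached at two points [xi] and [eta] that are antipodes for both
    [x] and [y] ([mdist_attained]); rays towards [xi] and [eta] therefore
    prolong any geodesic from [x] to [y] ([geodesically_complete_moebius]).

    For the compactification, [M] and [Z] are put together and a point [u] is
    represented by its profile, the function [expR (- (u | a))] of [a] in [Z],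
    with the supremum distance of profiles. Exponentials of Gromov products of
    arbitrary pairs are maxima of profiles against weights that are at most 1
    ([pairing_ge], [pairing_attained]); this makes them 1-Lipschitz in each
    variable, which yields continuity of the extended Gromov products,
    separation, equicontinuity of profiles and the description of balls by
    closed conditions. Along an ultrafilter profiles converge, and the limit is
    the profile of an ideal point or of an interior one according to whether it
    vanishes somewhere ([bordification_compact]). Balls contain no ideal point,
    so [M] is proper.

    In any Gromov product space [X] with compactification [K], identities
    between Gromov products pass from [X] to [K] by density. Prolonging
    geodesics shows that every point has an antipode at infinity
    ([boundary_antipode]), so that the functions [rho_x] are antipodal and that
    [x] is determined by [rho_x], with [d x y] the supremum of the logarithmic
    derivative of [rho_y] with respect to [rho_x] ([mdist_pullback]). Carrying
    [rho_y] to [Z] by a Moebius homeomorphism is then an isometric embedding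
    of [Y] in [M]. Maps of compactifications, both for the uniqueness behind
    [filling] and for the extension required by maximality, are defined as the
    solution [u] of a closed relation with [v]: a solution exists for [v] in the
    dense part, hence everywhere by compactness, it is unique because Gromov
    products separate points ([visual_separates], [boundary_separates]), and a
    map with a closed graph in a compact space is continuous. *)

(** * Topological preliminaries *)

(** The tube lemma: each [b] has a neighbourhood on which the estimate holds
    for [a'] near [a], and compactness leaves finitely many of them. *)
Lemma uniformly_near (R : realType) (S T : topologicalType) (rho : S -> T -> R) :
  compact [set: T] -> continuous (fun p : S * T => rho p.1 p.2) ->
  forall a e, 0 < e -> \forall a' \near a, forall b, `|rho a b - rho a' b| < e.
Proof.
move=> cT crho a e e0.
have := (compact_near_coveringP [set: T]).1 cT S (nbhs a)
  (fun a' b => `|rho a b - rho a' b| < e).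
have nab b : \forall p \near (a, b), `|rho a b - rho p.1 p.2| < e / 2.
  have /cvgrPdist_lt := crho (a, b); apply; exact: divr_gt0.
have cover b : [set: T] b ->
    \forall b' \near b & a' \near a, `|rho a b' - rho a' b'| < e.
  move=> _; have [[U V] /= [Ua Vb] UV] := nab b.
  exists (V, U) => // -[b' a'] /= [Vb' Ua'].
  have /= h1 := UV (a', b') (conj Ua' Vb').
  have /= h2 := UV (a, b') (conj (nbhs_singleton Ua) Vb').
  rewrite (_ : rho a b' - rho a' b' = (rho a b - rho a' b') - (rho a b - rho a b'));
    last by ring.
  by rewrite (le_lt_trans (ler_normB _ _))// [e]splitr ltrD.
by move=> /(_ _ cover); apply: filterS => a' h b; exact: h.
Qed.

Lemma continuous_pairl (S T U : topologicalType) (f : S * T -> U) t :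
  continuous f -> continuous (fun s => f (s, t)).
Proof.
move=> cf s; apply: (@continuous_comp _ _ _ (fun s => (s, t)) f); last exact: cf.
by apply: cvg_pair; [exact: cvg_id | exact: cvg_cst].
Qed.

Lemma continuous_pairr (S T U : topologicalType) (f : S * T -> U) s :
  continuous f -> continuous (fun t => f (s, t)).
Proof.
move=> cf t; apply: (@continuous_comp _ _ _ (fun t => (s, t)) f); last exact: cf.
by apply: cvg_pair; [exact: cvg_cst | exact: cvg_id].
Qed.

Lemma continuous_fst_comp (S T U : topologicalType) (f : S -> U) :
  continuous f -> continuous (fun p : S * T => f p.1).
Proof.
move=> cf p; apply: (@continuous_comp _ _ _ fst f); last exact: cf.
exact: cvg_fst.
Qed.

Lemma continuous_snd_comp (S T U : topologicalType) (f : T -> U) :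
  continuous f -> continuous (fun p : S * T => f p.2).
Proof.
move=> cf p; apply: (@continuous_comp _ _ _ snd f); last exact: cf.
exact: cvg_snd.
Qed.

Lemma continuous_pair_comp (S S' T T' U : topologicalType) (f : S -> S') (g : T -> T')
    (k : S' * T' -> U) : continuous f -> continuous g -> continuous k ->
  continuous (fun p : S * T => k (f p.1, g p.2)).
Proof.
move=> cf cg ck p; apply: (@continuous_comp _ _ _ (fun p => (f p.1, g p.2)) k); last exact: ck.
by apply: cvg_pair; [exact: continuous_fst_comp | exact: continuous_snd_comp].
Qed.

Lemma continuous_diag (S U : topologicalType) (f : S * S -> U) :
  continuous f -> continuous (fun s => f (s, s)).
Proof.
move=> cf s; apply: (@continuous_comp _ _ _ (fun s => (s, s)) f); last exact: cf.
by apply: cvg_pair; exact: cvg_id.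
Qed.

Section RealValued.
Context {R : realType} {T : topologicalType}.
Implicit Types f g : T -> R.

Lemma continuous_mul f g : continuous f -> continuous g ->
  continuous (fun u => f u * g u).
Proof. by move=> cf cg u; apply: cvgM; [exact: cf | exact: cg]. Qed.

Lemma continuous_sqr f : continuous f -> continuous (fun u => f u ^+ 2).
Proof. by move=> cf; exact: (continuous_mul cf cf). Qed.

Lemma continuous_scale c f : continuous f -> continuous (fun u => c * f u).
Proof. by move=> cf; apply: continuous_mul => // u; exact: cvg_cst. Qed.

Lemma continuous_inv f : continuous f -> (forall u, 0 < f u) ->
  continuous (fun u => (f u)^-1).
Proof. by move=> cf f0 u; apply: cvgV; [rewrite gt_eqF | exact: cf]. Qed.

Lemma open_lt_continuous f g : continuous f -> continuous g ->
  open [set u | f u < g u].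
Proof.
move=> cf cg.
rewrite (_ : mkset _ = (fun u => g u - f u) @^-1` [set t : R | 0 < t]); last first.
  by apply/seteqP; split => u /=; rewrite subr_gt0.
apply: open_comp => [u _|]; last exact: open_gt.
by apply: cvgB; [exact: cg | exact: cf].
Qed.

Lemma closed_le_continuous f g : continuous f -> continuous g ->
  closed [set u | f u <= g u].
Proof.
move=> cf cg.
rewrite (_ : mkset _ = (fun u => g u - f u) @^-1` [set t : R | 0 <= t]); last first.
  by apply/seteqP; split => u /=; rewrite subr_ge0.
apply: closed_comp => [u _|]; last exact: closed_ge.
by apply: cvgB; [exact: cg | exact: cf].
Qed.

Lemma closed_eq_continuous f g : continuous f -> continuous g ->
  closed [set u | f u = g u].
Proof.
move=> cf cg.
rewrite (_ : mkset _ = [set u | f u <= g u] `&` [set u | g u <= f u]).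
  by apply: closedI; exact: closed_le_continuous.
apply/seteqP; split => [u /= ->|u /= [fg gf]]; first by rewrite lexx.
by apply/le_anti; rewrite fg.
Qed.

End RealValued.

(** A cluster point of the image is a limit, because an ultrafilter contains
    the preimage of a neighbourhood or that of its complement. *)
Lemma ultra_cvg_compact (X : Type) (T : topologicalType) (F : set_system X)
    (f : X -> T) (A : set T) : UltraFilter F -> compact A -> (forall u, A (f u)) ->
  exists2 l, A l & f @ F --> l.
Proof.
move=> UF cA fA; have FA : (f @ F) A.
  by apply: (@filterS _ F _ setT); [move=> u _; exact: fA | exact: filterT].
have [l [Al Fl]] := cA (f @ F) _ FA.
exists l => // V Vl; have [//|FV] := in_ultra_setVsetC (f @^-1` V) UF.
by have [u []] := Fl (~` V) V FV Vl.
Qed.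

(** If [s] has no partner, each [t] has a neighbourhood in which no [s'] near
    [s] finds one, and finitely many of these cover the compact factor. *)
Lemma closed_proj (S T : topologicalType) (C : set (S * T)) :
  compact [set: T] -> closed C -> closed [set s | exists t, C (s, t)].
Proof.
move=> cT cC; rewrite -openC openE => s /= nC.
have cover t : [set: T] t -> \forall t' \near t & s' \near s, ~ C (s', t').
  move=> _; have /open_nbhs_nbhs : open_nbhs (s, t) (~` C).
    by split; [exact: closed_openC | move=> Cst; apply: nC; exists t].
  by move=> [[U V] /= [Us Vt] UV]; exists (V, U) => // -[t' s'] /= [? ?]; exact: UV (s', t') _.
have := (compact_near_coveringP [set: T]).1 cT S (nbhs s) (fun s' t' => ~ C (s', t'))
  (nbhs_filter s) cover.
by apply: filterS => s' h [t /(h t I)].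
Qed.

(** The maps between compactifications constructed below are unique solutions
    of closed relations, and this is how their continuity is obtained. Outside
    a neighbourhood of [h s] the relation fails at [s]; by compactness it still
    fails there for all [s'] near [s]. *)
Lemma continuous_closed_graph (S T : topologicalType) (C : set (S * T)) (h : S -> T) :
  compact [set: T] -> closed C -> (forall s, C (s, h s)) ->
  (forall s t, C (s, t) -> t = h s) -> continuous h.
Proof.
move=> cT cC hC hU s V; rewrite nbhsE => -[U [oU Us] UV].
have cU : compact (~` U).
  by apply: (subclosed_compact _ cT) => //; exact: open_closedC.
have cover t : (~` U) t -> \forall t' \near t & s' \near s, ~ C (s', t').
  move=> Ut; have /open_nbhs_nbhs : open_nbhs (s, t) (~` C).
    by split; [exact: closed_openC | move=> /hU E; apply: Ut; rewrite E].
  by move=> [[A B] /= [As Bt] AB]; exists (B, A) => // -[t' s'] /= [? ?]; exact: AB (s', t') _.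
have := (compact_near_coveringP (~` U)).1 cU S (nbhs s) (fun s' t' => ~ C (s', t'))
  (nbhs_filter s) cover.
apply: filterS => s' hs' /=; apply: UV; apply: contrapT => Uh.
exact: hs' Uh (hC s').
Qed.

(** * Closed conditions on a compactification *)

(** The principle by which relations between Gromov products, checked on
    distances in [X], hold on all of [K]. *)
Lemma dense_closed_ind (X : topologicalType) (K : compactification X) (A : set K) :
  closed A -> (forall y, A (cpt_emb K y)) -> forall u, A u.
Proof.
move=> cA hA u; apply: contrapT => Au.
have [|v [Av [y _ yv]]] := @cpt_dense X K (~` A) _ (closed_openC cA); first by exists u.
by apply: Av; rewrite -yv.
Qed.

Lemma dense_closed_ind2 (X Y : topologicalType) (K : compactification X)
    (L : compactification Y) (A : set (K * L)) :
  closed A -> (forall x y, A (cpt_emb K x, cpt_emb L y)) -> forall p, A p.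
Proof.
move=> cA hA [u v].
apply: (@dense_closed_ind _ L [set v | A (u, v)]) => [|y /=].
  apply: (closed_comp _ cA) => w _.
  by apply: cvg_pair; [exact: cvg_cst | exact: cvg_id].
apply: (@dense_closed_ind _ K [set u | A (u, cpt_emb L y)]) => [|x /=]; last exact: hA.
apply: (closed_comp _ cA) => w _.
by apply: cvg_pair; [exact: cvg_id | exact: cvg_cst].
Qed.

Lemma boundary_val_continuous (X : topologicalType) (K : compactification X) :
  continuous (\val : boundary K -> K).
Proof. exact: initial_continuous. Qed.

Lemma continuous_into_boundary (S X : topologicalType) (K : compactification X)
    (f : S -> boundary K) : continuous (\val \o f) -> continuous f.
Proof. exact: continuous_comp_initial. Qed.

(** * Exponentials of extended reals *)

Lemma ler_distN_expR (R : realType) (p q : R) : 0 <= p -> 0 <= q ->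
  `|expR (- p) - expR (- q)| <= `|p - q|.
Proof.
wlog pq : p q / p <= q => [hw p0 q0|p0 q0].
  case: (leP p q) => pq; first exact: hw.
  by rewrite distrC [leRHS]distrC hw// ltW.
rewrite ger0_norm ?subr_ge0 ?ler_expR ?lerN2// distrC ger0_norm ?subr_ge0//.
have -> : expR (- q) = expR (- p) * expR (p - q) by rewrite -expRD; congr expR; ring.
rewrite -[X in X - _]mulr1 -mulrBr; apply: le_trans (_ : 1 - expR (p - q) <= _).
  rewrite ler_piMl ?subr_ge0 -?[leRHS]expR0 ?ler_expR; lra.
by have := expR_ge1Dx (p - q); lra.
Qed.

Section ExtendedReals.
Context {R : realType}.

(** It takes the value [+oo] on all nonpositive reals, and so is continuous
    on the whole line. *)
Definition neglog (r : R) : \bar R := (- lne r%:E)%E.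

(** Gromov products are handled through this exponential, for which the value
    [+oo] becomes [0] and all the functions in play take values in [[0, 1]]. *)
Definition expN (t : \bar R) : R := fine (expeR (- t)%E).

Lemma neglog_expR (t : R) : neglog (expR t) = (- t)%:E.
Proof. by rewrite /neglog lne_EFin ?expR_gt0// expRK. Qed.

Lemma neglog_ge0 (r : R) : r <= 1 -> (0 <= neglog r)%E.
Proof. by move=> r1; rewrite /neglog oppe_ge0 lne_le0 lee_fin. Qed.

Lemma neglog_eqy (r : R) : 0 <= r -> neglog r = +oo%E <-> r = 0.
Proof.
move=> r0; split=> [|->]; last by rewrite /neglog le0_lneNy.
have [-> //|rn0] := eqVneq r 0.
by rewrite /neglog lne_EFin// lt_neqAle eq_sym rn0.
Qed.

Lemma neglog_continuous : continuous neglog.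
Proof.
move=> r; apply: cvgeN; have [r0|r0] := ltP 0 r.
  rewrite lne_EFin//; apply: (@cvg_trans _ ((fun t => (ln t)%:E) @ r)).
    apply: near_eq_cvg; near=> t; rewrite lne_EFin//.
    by near: t; exact: lt_nbhsr.
  by move=> A h; exact: (@continuous_ln R r r0 [set s | A s%:E] h).
rewrite le0_lneNy ?lee_fin//; apply/cvgeNyPle => A; near=> t.
have tA : t < expR A.
  by near: t; apply: lt_nbhsl; apply: le_lt_trans r0 _; exact: expR_gt0.
have [t0|t0] := ltP 0 t; last by rewrite le0_lneNy ?lee_fin// leNye.
by rewrite lne_EFin// lee_fin -[leRHS]expRK ler_ln ?posrE ?expR_gt0// ltW.
Unshelve. all: by end_near. Qed.

Lemma expN_ge0 t : 0 <= expN t.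
Proof. by rewrite /expN fine_ge0// expeR_ge0. Qed.

Lemma expN_le1 t : (0 <= t)%E -> expN t <= 1.
Proof.
case: t => [t| |]; rewrite /expN //= ?lee_fin => t0.
by rewrite -[leRHS]expR0 ler_expR oppr_le0.
Qed.

Lemma expN_EFin (t : R) : expN t%:E = expR (- t).
Proof. by []. Qed.

Lemma expN_eq0 t : (0 <= t)%E -> expN t = 0 <-> t = +oo%E.
Proof.
case: t => [t| |] // t0; split => // /eqP.
by rewrite expN_EFin gt_eqF ?expR_gt0.
Qed.

(** Continuity fails at [-oo], where [fine] sends [+oo] to [0]. *)
Lemma expN_continuous_at t : (0 <= t)%E -> {for t, continuous expN}.
Proof.
case: t => [t| |] // t0.
  rewrite /prop_for /continuous_at expN_EFin => A /= h.
  suff : nbhs t (fun s => A (expN s%:E)) by [].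
  have : (fun s => expR (- s)) @ t --> expR (- t).
    by apply: continuous_cvg; [exact: continuous_expR | exact: cvgN].
  exact.
apply/(@cvgrPdist_le _ _ _ _ (nbhs_filter (+oo%E : \bar R))) => e e0.
exists (- ln e); split; first exact: num_real.
move=> x /=; rewrite sub0r normrN.
case: x => [x| |] //=; last by rewrite normr0 => _; exact: ltW.
by rewrite lte_fin ger0_norm ?expR_ge0// => ex; rewrite -[leRHS]lnK ?posrE// ler_expR; lra.
Qed.

Lemma expN_inj s t : (0 <= s)%E -> (0 <= t)%E ->
  expN s = expN t -> s = t.
Proof.
move=> s0 t0 E; have [sy|sy] := eqVneq s +oo%E.
  by move: E; rewrite sy => /esym/(expN_eq0 t0) ->.
have [ty|ty] := eqVneq t +oo%E.
  by move: E; rewrite ty => /(expN_eq0 s0).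
have fs : s \is a fin_num by rewrite ge0_fin_numE// lt_neqAle sy leey.
have ft : t \is a fin_num by rewrite ge0_fin_numE// lt_neqAle ty leey.
move: E; rewrite -(fineK fs) -(fineK ft) !expN_EFin => /expR_inj/oppr_inj.
by move=> ->.
Qed.

End ExtendedReals.

(** * The tight span of a bounded kernel *)

Section TightSpan.
Context {R : realType} {I : Type}.
Variable L : I -> I -> R.
Hypothesis L_ge0 : forall a b, 0 <= L a b.
Hypothesis L_le1 : forall a b, L a b <= 1.
Hypothesis L_sym : forall a b, L a b = L b a.
Hypothesis L_antipode : forall a, exists b, L a b = 1.
Implicit Types (f g : I -> R) (C c : R).

Definition bounded_by C f := forall a, `|f a| <= C.

(** The largest value at [a] compatible with [expR (f a + f b) * L a b <= 1] for
    all [b]. Functions with [f <= star f] are called subtight, and those with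
    [f = star f] tight. *)
Definition star f a : R := - ln (sup (range (fun b => expR (f b) * L a b))).

Definition mean f a : R := (f a + star f a) / 2.

(** Averaging [f] with [star f] keeps [f] subtight, increases it and halves the
    gap to [star f], so the iterates converge upwards to a tight function:
    this is Dress's retraction onto a tight span. *)
Definition tighten f a : R := sup (range (fun n => iter n mean f a)).

Lemma bounded_by_itv C f a : bounded_by C f -> - C <= f a <= C.
Proof. by move=> /(_ a); rewrite ler_norml. Qed.

Lemma star_sup C f a : bounded_by C f ->
  [/\ expR (- star f a) = sup (range (fun b => expR (f b) * L a b)),
      expR (- C) <= expR (- star f a) <= expR C &
      forall b, expR (f b) * L a b <= expR (- star f a)].
Proof.
move=> fC; rewrite /star opprK; set S := (X in ln (sup X)).
have SC : ubound S (expR C).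
  move=> _ [b _ <-]; rewrite -[leRHS]mulr1 ler_pM ?expR_ge0//.
  by rewrite ler_expR; have /andP[] := bounded_by_itv b fC.
have hS b : expR (f b) * L a b <= sup S.
  by apply: ub_le_sup; [exists (expR C) | exists b].
have S1 : expR (- C) <= sup S.
  have [b ab] := L_antipode a; apply: le_trans (hS b).
  by rewrite ab mulr1 ler_expR; have /andP[] := bounded_by_itv b fC.
have S2 : sup S <= expR C.
  by apply: ge_sup => //; have [b _] := L_antipode a; exists (expR (f b) * L a b), b.
by rewrite lnK ?posrE ?(lt_le_trans _ S1) ?expR_gt0 // S1 S2.
Qed.

Lemma star_le C f a b : bounded_by C f -> expR (f b) * L a b <= expR (- star f a).
Proof. by move=> /star_sup -/(_ a)[]. Qed.

Lemma star_bounded C f : bounded_by C f -> bounded_by C (star f).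
Proof.
move=> /star_sup fC a; have [_ /andP[]] := fC a.
by rewrite !ler_expR ler_norml => *; lra.
Qed.

Lemma le_star C f a c : bounded_by C f ->
  (forall b, expR (f b) * L a b <= expR (- c)) -> c <= star f a.
Proof.
move=> fC h; have [E _ _] := star_sup a fC; rewrite -lerN2 -ler_expR E.
apply: ge_sup; last by move=> _ [b _ <-].
by have [b _] := L_antipode a; exists (expR (f b) * L a b), b.
Qed.

(** With [c = 0] this says that [star] reverses the order; applied both ways,
    that it is 1-Lipschitz for the supremum distance. *)
Lemma star_antimono C f g c a : bounded_by C f -> bounded_by C g ->
  (forall b, f b <= g b + c) -> star g a - c <= star f a.
Proof.
move=> fC gC fg; apply: (le_star fC) => b.
rewrite (_ : - (star g a - c) = c - star g a); last by ring.
rewrite expRD; apply: le_trans (_ : expR c * (expR (g b) * L a b) <= _).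
  by rewrite mulrA -expRD ler_wpM2r// ler_expR addrC.
by rewrite ler_wpM2l ?expR_ge0//; exact: star_le gC.
Qed.

Lemma subtight_le1 C f a b : bounded_by C f -> (forall a, f a <= star f a) ->
  expR (f a + f b) * L a b <= 1.
Proof.
move=> fC fs; rewrite expRD -mulrA.
apply: le_trans (_ : expR (f a) * expR (- star f a) <= 1).
  by rewrite ler_wpM2l ?expR_ge0//; exact: star_le fC.
by rewrite -expRD -[leRHS]expR0 ler_expR; have := fs a; lra.
Qed.

Lemma le1_subtight C f a : bounded_by C f ->
  (forall b, expR (f a + f b) * L a b <= 1) -> f a <= star f a.
Proof.
move=> fC h; apply: (le_star fC) => b.
by rewrite expRN -div1r ler_pdivlMr ?expR_gt0// mulrAC -expRD addrC.
Qed.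

Section Iteration.
Variables (C : R) (f : I -> R).
Hypothesis fC : bounded_by C f.
Hypothesis fs : forall a, f a <= star f a.

Lemma mean_bounded : bounded_by C (mean f).
Proof.
move=> a; have := bounded_by_itv a fC; have := bounded_by_itv a (star_bounded fC).
by rewrite /mean ler_norml => /andP[? ?] /andP[? ?]; lra.
Qed.

Lemma mean_ge a : f a <= mean f a.
Proof. by have := fs a; rewrite /mean; lra. Qed.

(** The exponent [mean f a + mean f b] is the average of [f a + star f b] and
    [f b + star f a]. Both of these satisfy the bound, so the larger one does. *)
Lemma mean_subtight a : mean f a <= star (mean f) a.
Proof.
apply: (le1_subtight mean_bounded) => b.
have h1 := star_le b a fC; have h2 := star_le a b fC; rewrite L_sym in h1.
have key x y : expR x * L a b <= expR (- y) -> expR (x + y) * L a b <= 1.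
  by rewrite expRN -div1r ler_pdivlMr ?expR_gt0// mulrAC -expRD.
move: (key _ _ h1) (key _ _ h2); rewrite /mean.
set u := f a + _; set v := f b + _ => uL vL.
have -> : (f a + star f a) / 2 + (f b + star f b) / 2 = (u + v) / 2.
  by rewrite /u /v; field.
case: (leP u v) => uv; [apply: le_trans vL | apply: le_trans uL];
  by rewrite ler_wpM2r// ler_expR; lra.
Qed.

(** [mean f] lies halfway between [f] and [star f], and passing from [f] to
    the larger function [mean f] only decreases [star]. *)
Lemma mean_gap a : star (mean f) a - mean f a <= (star f a - f a) / 2.
Proof.
have : star (mean f) a - 0 <= star f a.
  by apply: (star_antimono _ fC mean_bounded) => b; rewrite addr0 mean_ge.
rewrite [mean f a]/mean.
by move: (star (mean f) a) (star f a) (f a) => *; lra.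
Qed.

End Iteration.

Section Limit.
Variables (C : R) (f : I -> R).
Hypothesis fC : bounded_by C f.
Hypothesis fs : forall a, f a <= star f a.

Local Notation f_ n := (iter n mean f).

Lemma iter_mean n : [/\ bounded_by C (f_ n), forall a, f_ n a <= star (f_ n) a &
  forall a, star (f_ n) a - f_ n a <= 2 * C / 2 ^+ n].
Proof.
elim: n => [|n [IH1 IH2 IH3]] /=.
  split=> // a; rewrite expr0 divr1.
  have := bounded_by_itv a fC; have := bounded_by_itv a (star_bounded fC).
  by move=> /andP[? ?] /andP[? ?]; lra.
split=> [||a]; [exact: mean_bounded | exact: mean_subtight IH1 |].
apply: le_trans (mean_gap IH1 IH2 a) _.
by rewrite exprSr invfM mulrA ler_wpM2r.
Qed.

Lemma iter_mean_mono n m a : (n <= m)%N -> f_ n a <= f_ m a.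
Proof.
move=> /subnKC <-; elim: (m - n)%N => [|k IH]; first by rewrite addn0.
rewrite addnS /=; apply: le_trans IH _.
by have [h1 h2 _] := iter_mean (n + k); apply: mean_ge.
Qed.

(** All iterates lie below all their duals: compare both with the iterate of
    larger index. *)
Lemma iter_mean_le_star n m a : f_ m a <= star (f_ n) a.
Proof.
have [hn1 hn2 _] := iter_mean n; have [hm1 hm2 _] := iter_mean m.
case: (leqP m n) => mn.
  by apply: le_trans (hn2 a); exact: iter_mean_mono.
apply: le_trans (hm2 a) _; rewrite -[leLHS]subr0.
by apply: (star_antimono _ hn1 hm1) => b; rewrite addr0 iter_mean_mono// ltnW.
Qed.

Lemma tighten_ge_iter n a : f_ n a <= tighten f a.
Proof.
apply: ub_le_sup; last by exists n.
by exists (star (f_ 0) a) => _ [m _ <-]; exact: iter_mean_le_star.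
Qed.

Lemma tighten_le a c : (forall n, f_ n a <= c) -> tighten f a <= c.
Proof. by move=> h; apply: ge_sup; [exists (f a), 0%N | move=> _ [n _ <-]]. Qed.

Lemma tighten_ge a : f a <= tighten f a.
Proof. exact: (tighten_ge_iter 0). Qed.

Lemma tighten_bounded : bounded_by C (tighten f).
Proof.
move=> a; rewrite ler_norml; apply/andP; split.
  by apply: le_trans (tighten_ge a); have /andP[] := bounded_by_itv a fC.
apply: tighten_le => n; have [h _ _] := iter_mean n.
by have /andP[] := bounded_by_itv a h.
Qed.

Lemma le_geometric (x y : R) : (forall n, x <= y + 2 * C / 2 ^+ n) -> x <= y.
Proof.
move=> h; apply/ler_addgt0Pr => e e0.
have [n /ltW hn] : exists n, 2 * C / 2 ^+ n < e.
  pose N := Num.truncn (2 * C / e).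
  exists N.+1; rewrite ltr_pdivrMr ?exprn_gt0// [ltRHS]mulrC -ltr_pdivrMr//.
  apply: (lt_le_trans (truncnS_gt _)).
  by rewrite -[2]/(2%:R) -natrX ler_nat ltnW// ltn_expl.
by apply: le_trans (h n) _; rewrite lerD2l.
Qed.

(** [tighten f] lies between the [n]-th iterate and its dual, whose gap is at
    most [2 * C / 2 ^+ n]; so does [star (tighten f)], up to the same error. *)
Lemma star_tighten : star (tighten f) = tighten f.
Proof.
apply/funext => a; apply/le_anti/andP; split; apply: le_geometric => n;
  have [hn1 hn2 hn3] := iter_mean n.
  have : star (tighten f) a - 0 <= star (f_ n) a.
    by apply: (star_antimono _ hn1 tighten_bounded) => b; rewrite addr0 tighten_ge_iter.
  move: (hn3 a) (tighten_ge_iter n a).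
  by move: (star (tighten f) a) (star (f_ n) a) (f_ n a) (tighten f a) => *; lra.
have : star (f_ n) a - 2 * C / 2 ^+ n <= star (tighten f) a.
  apply: (star_antimono _ tighten_bounded hn1) => b.
  apply: le_trans (_ : star (f_ n) b <= _); last by have := hn3 b; lra.
  by apply: tighten_le => m; exact: iter_mean_le_star.
have : tighten f a <= star (f_ n) a.
  by apply: tighten_le => m; exact: iter_mean_le_star.
by move: (star (tighten f) a) (star (f_ n) a) (tighten f a) => *; lra.
Qed.

End Limit.

Lemma tighten_id f : star f = f -> tighten f = f.
Proof.
move=> fE; have itE n : iter n mean f = f.
  by elim: n => //= n ->; apply/funext => a; rewrite /mean fE; field.
apply/funext => a; rewrite /tighten [X in sup X](_ : _ = [set f a]) ?sup1//.
by apply/seteqP; split=> [_ [n _ <-]|_ ->]; [rewrite itE | exists 0%N].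
Qed.

(** [star] is 1-Lipschitz for the supremum distance, hence so are [mean], its
    iterates and their limits. *)
Lemma tighten_lip C f g c : bounded_by C f -> bounded_by C g ->
  (forall a, f a <= star f a) -> (forall a, g a <= star g a) ->
  (forall a, `|f a - g a| <= c) -> forall a, `|tighten f a - tighten g a| <= c.
Proof.
move=> fC gC fs gs fg.
have it n a : `|iter n mean f a - iter n mean g a| <= c.
  elim: n a => [//|n IH] a /=.
  have [f1 f2 _] := iter_mean fC fs n; have [g1 g2 _] := iter_mean gC gs n.
  have h1 : star (iter n mean g) a - c <= star (iter n mean f) a.
    by apply: (star_antimono _ f1 g1) => b; have := IH b; rewrite ler_norml; lra.
  have h2 : star (iter n mean f) a - c <= star (iter n mean g) a.
    by apply: (star_antimono _ g1 f1) => b; have := IH b; rewrite ler_norml; lra.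
  move: (IH a) h1 h2; rewrite ![mean (iter _ _ _) a]/mean !ler_norml.
  move: (star (iter n mean f) a) (star (iter n mean g) a) (iter n mean f a) (iter n mean g a).
  by move=> u v p q /andP[? ?] *; lra.
move=> a.
have h1 : tighten f a <= tighten g a + c.
  apply: tighten_le => n; have := it n a; have := tighten_ge_iter gC gs n a.
  by rewrite ler_norml; lra.
have h2 : tighten g a <= tighten f a + c.
  apply: tighten_le => n; have := it n a; have := tighten_ge_iter fC fs n a.
  by rewrite ler_norml; lra.
by rewrite ler_norml; lra.
Qed.

End TightSpan.

(** * Points of the Moebius space as functions on the antipodal space *)

Section MoebiusSpace.
Context {R : realType} {Z : antipodalSpace R}.
Local Notation M := (moebius_space Z).
Implicit Types (x y z : M) (a b c : Z).

(** Halving the logarithm removes the squares from [is_derivative]: see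
    [mpt_half_log]. *)
Definition half_log x y a : R := ln (derivative x y a) / 2.

Lemma mpt_ge0 x a b : 0 <= x a b.
Proof. by have [] := mpt_sep x. Qed.

Lemma mpt_sym x a b : x a b = x b a.
Proof. by have [] := mpt_sep x. Qed.

Lemma mpt_eq0 x a b : x a b = 0 <-> a = b.
Proof. by have [] := mpt_sep x. Qed.

Lemma mpt_continuous x : continuous (fun p : Z * Z => x p.1 p.2).
Proof. by have [] := mpt_sep x. Qed.

Lemma mpt_antipode x a : exists b, x a b = 1.
Proof. by have [_ _] := mpt_antipodal x. Qed.

Lemma mpt_le1 x a b : x a b <= 1.
Proof.
have [_ s1 _] := mpt_antipodal x; rewrite -s1.
apply: ub_le_sup; last by exists (a, b).
apply: contrapT => h; move: s1; rewrite sup_out => [/eqP|[] //].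
by rewrite eq_sym oner_eq0.
Qed.

Lemma mpt_gt0 x a b : a != b -> 0 < x a b.
Proof.
by move=> ab; rewrite lt_neqAle mpt_ge0 andbT eq_sym; apply: contra_neq ab => /mpt_eq0.
Qed.

Lemma mptl_continuous x a : continuous (x a).
Proof.
move=> b; apply: (@continuous_comp _ _ _ (fun b => (a, b)) (fun p => x p.1 p.2)).
  by apply: cvg_pair; [exact: cvg_cst | exact: cvg_id].
exact: mpt_continuous.
Qed.

Lemma derivative_half_log x y a : derivative x y a = expR (half_log x y a + half_log x y a).
Proof.
have [_ D0 _] := mpt_derivativeP x y.
by rewrite /half_log -splitr lnK// posrE.
Qed.

Lemma mpt_half_log x y a b :
  y a b = expR (half_log x y a + half_log x y b) * x a b.
Proof.
have [_ _ DE] := mpt_derivativeP x y.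
apply: (pexpIrn (n := 2)); rewrite ?nnegrE ?mpt_ge0// ?mulr_ge0 ?expR_ge0 ?mpt_ge0//.
rewrite DE !derivative_half_log exprMn; congr (_ * _).
by rewrite expr2 -!expRD; congr expR; ring.
Qed.

Lemma half_log_continuous x y : continuous (half_log x y).
Proof.
have [cD D0 _] := mpt_derivativeP x y.
move=> a; apply: cvgM; last exact: cvg_cst.
by apply: continuous_cvg; [exact: continuous_ln|exact: cD].
Qed.

Lemma half_log_unique x y (g : Z -> R) : continuous g ->
  (forall a b, y a b = expR (g a + g b) * x a b) -> half_log x y = g.
Proof.
move=> cg gE.
have gP : is_derivative x y (fun a => expR (g a + g a)).
  split => [a|a|a b]; [|exact: expR_gt0|].
    by apply: continuous_cvg; [exact: continuous_expR|apply: cvgD; exact: cg].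
  by rewrite gE exprMn; congr (_ * _); rewrite expr2 -!expRD; congr expR; ring.
have E := derivative_unique (@apt_four _ Z) (mpt_sep x) gP (mpt_derivativeP x y).
by apply/funext => a; rewrite /half_log -E expRK; lra.
Qed.

Lemma half_log_refl x a : half_log x x a = 0.
Proof.
rewrite (@half_log_unique x x (fun=> 0))//; first by move=> b; exact: cvg_cst.
by move=> b c; rewrite addr0 expR0 mul1r.
Qed.

Lemma half_log_chain x y z a : half_log x z a = half_log x y a + half_log y z a.
Proof.
rewrite (@half_log_unique x z (fun a => half_log x y a + half_log y z a))//.
  by move=> b; apply: cvgD; exact: half_log_continuous.
move=> b c; rewrite (mpt_half_log y z) (mpt_half_log x y) mulrA -expRD.
apply: (congr1 (fun t => expR t * x b c)).
by move: (half_log x y b) (half_log x y c) (half_log y z b) (half_log y z c) => *; ring.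
Qed.

Lemma half_log_inv x y a : half_log y x a = - half_log x y a.
Proof. by apply/eqP; rewrite -addr_eq0 -half_log_chain half_log_refl. Qed.

Lemma half_log_le x y a : `|half_log x y a| <= mdist x y / 2.
Proof.
have hub : has_ubound (range (fun a => `|ln (derivative x y a)|)).
  have cf : continuous (fun a => `|ln (derivative x y a)|).
    have [cD D0 _] := mpt_derivativeP x y.
    move=> b; apply: cvg_norm.
    by apply: continuous_cvg; [exact: continuous_ln|exact: cD].
  have [|c _ hc] := compact_EVT_max _ (@apt_compact _ Z) (continuous_subspaceT cf).
    by exists a.
  by exists (`|ln (derivative x y c)|) => _ [b _ <-]; apply: hc; rewrite inE.
rewrite /half_log normrM (@ger0_norm _ 2^-1)// ler_wpM2r//.
by apply: ub_le_sup => //; exists a.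
Qed.

Lemma mdist_moebius_le x y (r : R) :
  (forall a, `|half_log x y a| <= r / 2) -> mdist x y <= r.
Proof.
move=> h; apply: ge_sup => [|_ [a _ <-]].
  by have [a _] := @apt_four _ Z; exists `|ln (derivative x y a)|, a.
by have := h a; rewrite /half_log normrM (@ger0_norm _ 2^-1)// ler_pM2r.
Qed.

(** Otherwise [y a b] would exceed 1. *)
Lemma half_log_antipode_le x y a b : x a b = 1 -> half_log x y b <= - half_log x y a.
Proof.
move=> ab; have := mpt_le1 y a b.
by rewrite (mpt_half_log x y) ab mulr1 -[leRHS]expR0 ler_expR; lra.
Qed.

(** The maximum of [half_log x y] is also its supremum in absolute value: an
    antipode of [b] with respect to [y] has a value at least
    [- half_log x y b]. *)
Lemma half_log_max x y : exists2 a, half_log x y a = mdist x y / 2 &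
  forall b, half_log x y b <= half_log x y a.
Proof.
have [a0 _] := @apt_four _ Z.
have [|a _ ha] := compact_EVT_max _ (@apt_compact _ Z)
  (continuous_subspaceT (@half_log_continuous x y)).
  by exists a0.
have {}ha b : half_log x y b <= half_log x y a by apply: ha; rewrite inE.
exists a => //; apply/le_anti/andP; split.
  by apply: le_trans (half_log_le x y a); exact: ler_norm.
suff : mdist x y <= half_log x y a + half_log x y a by lra.
apply: mdist_moebius_le => b.
rewrite (_ : (half_log x y a + _) / 2 = half_log x y a); last by lra.
rewrite ler_norml ha andbT.
have [c yc] := mpt_antipode y b; rewrite mpt_sym in yc.
have := half_log_antipode_le x yc; rewrite !(half_log_inv x y).
by have := ha c; lra.
Qed.

(** An antipode, with respect to [x], of a maximum of [half_log x y] is a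
    minimum of it, and is still an antipode with respect to [y]. The two points
    are the directions in which geodesics from [x] to [y] can be prolonged. *)
Lemma mdist_attained x y : exists a b, [/\ x a b = 1, y a b = 1,
  half_log x y a = mdist x y / 2 & half_log x y b = - (mdist x y / 2)].
Proof.
have [a aE _] := half_log_max x y; have [b ab] := mpt_antipode x a.
have bE : half_log x y b = - (mdist x y / 2).
  have := half_log_le x y b; rewrite ler_norml => /andP[h _].
  by apply/le_anti; rewrite h -aE half_log_antipode_le.
by exists a, b; split => //; rewrite (mpt_half_log x y) aE bE addrN expR0 mul1r.
Qed.

(** Antipodality is tightness: [y <= 1] is the inequality [<=] and the
    existence of antipodes for [y] is the equality. *)
Lemma star_half_log x y : star x (half_log x y) = half_log x y.
Proof.
have hC : bounded_by (mdist x y / 2) (half_log x y) by exact: half_log_le.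
have xa := mpt_antipode x.
apply/funext => a; apply/le_anti/andP; split; last first.
  apply: (le1_subtight (mpt_ge0 x) (mpt_le1 x) xa hC) => b.
  by rewrite -mpt_half_log mpt_le1.
have [b yb] := mpt_antipode y a.
have := star_le (mpt_ge0 x) (mpt_le1 x) xa a b hC.
have -> : expR (half_log x y b) * x a b = expR (- half_log x y a).
  apply: (mulfI (lt0r_neq0 (expR_gt0 (half_log x y a)))).
  by rewrite mulrA -!expRD subrr expR0 -mpt_half_log.
by rewrite ler_expR lerN2.
Qed.

(** Continuity of [f] comes for free: [expR (- f)] is the supremum of the
    functions [expR (f b) * x a b] of [a], which have a common modulus of
    continuity since [f] is bounded. Compactness then turns the supremum into
    a maximum, which provides antipodes. *)
Lemma mpt_of_tight x C (f : Z -> R) : bounded_by C f -> star x f = f ->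
  exists y, half_log x y = f.
Proof.
move=> fC fE; have xa := mpt_antipode x.
have fS a : [/\ expR (- f a) = sup (range (fun b => expR (f b) * x a b)),
    expR (- C) <= expR (- f a) <= expR C &
    forall b, expR (f b) * x a b <= expR (- f a)].
  by have := star_sup (mpt_ge0 x) (mpt_le1 x) xa a fC; rewrite fE.
have key a a' e : (forall b, `|x a b - x a' b| < e) ->
    expR (- f a) <= expR (- f a') + expR C * e.
  move=> h; have [-> _ _] := fS a; apply: ge_sup.
    by exists (expR (f a) * x a a), a.
  move=> _ [b _ <-]; have [_ _ /(_ b) h'] := fS a'.
  rewrite -lerBlDl; apply: le_trans (_ : expR (f b) * (x a b - x a' b) <= _).
    by rewrite mulrBr lerD2l lerN2.
  apply: le_trans (_ : expR (f b) * e <= _).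
    by rewrite ler_wpM2l ?expR_ge0// ltW// (le_lt_trans (ler_norm _) (h b)).
  rewrite ler_wpM2r ?ler_expR//; first by rewrite ltW// (le_lt_trans _ (h b)).
  by have /andP[] := bounded_by_itv b fC.
have cexp : continuous (fun a => expR (- f a)).
  move=> a; apply/cvgrPdist_le => e e0.
  have e1 : 0 < e / expR C by rewrite divr_gt0 ?expR_gt0.
  have := uniformly_near (@apt_compact _ Z) (@mpt_continuous x) a e1.
  apply: filterS => a' h; rewrite ler_norml.
  have h1 := key a a' _ h; have h2 := key a' a (e / expR C).
  rewrite mulrC divfK ?gt_eqF ?expR_gt0// in h1.
  have /h2 {}h2 : forall b, `|x a' b - x a b| < e / expR C by move=> b; rewrite distrC.
  rewrite mulrC divfK ?gt_eqF ?expR_gt0// in h2.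
  by lra.
have cf : continuous f.
  have E : (fun a => - ln (expR (- f a))) = f by apply/funext => b; rewrite expRK opprK.
  rewrite -E => a; apply: cvgN; apply: continuous_cvg; last exact: cexp.
  by apply: continuous_ln; exact: expR_gt0.
have le1 a b : expR (f a + f b) * x a b <= 1.
  by apply: (subtight_le1 (mpt_ge0 x) (mpt_le1 x) xa _ _ fC) => c; rewrite fE.
have attained a : exists b, expR (f a + f b) * x a b = 1.
  have cg : continuous (fun b => expR (f b) * x a b).
    move=> b; apply: cvgM; last exact: mptl_continuous.
    by apply: continuous_cvg; [exact: continuous_expR | exact: cf].
  have [|b _ hb] := compact_EVT_max _ (@apt_compact _ Z) (continuous_subspaceT cg).
    by exists a.
  exists b; apply/le_anti; rewrite le1 expRD -mulrA -(ler_pM2l (expR_gt0 (- f a))) /=.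
  rewrite mulr1 [leRHS]mulrA -expRD addNr expR0 mul1r.
  have [-> _ _] := fS a; apply: ge_sup; first by exists (expR (f a) * x a a), a.
  by move=> _ [c _ <-]; apply: hb; rewrite inE.
pose rho a b := expR (f a + f b) * x a b.
have srho : separating rho.
  split=> [p|a b|a b|a b]; rewrite /rho.
  - apply: cvgM; last exact: mpt_continuous.
    apply: continuous_cvg; first exact: continuous_expR.
    by apply: cvgD; [apply: (@continuous_comp _ _ _ fst f)
      | apply: (@continuous_comp _ _ _ snd f)];
      [exact: cvg_fst|exact: cf|exact: cvg_snd|exact: cf].
  - by rewrite mulr_ge0 ?expR_ge0 ?mpt_ge0.
  - by rewrite addrC mpt_sym.
  - split=> [/eqP|/mpt_eq0 ->]; last by rewrite mulr0.
    by rewrite mulf_eq0 gt_eqF ?expR_gt0//= => /eqP/mpt_eq0.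
have arho : antipodal rho.
  split=> //; apply/le_anti/andP; split.
    apply: ge_sup; last by move=> _ [p _ <-]; exact: le1.
    by have [a _] := @apt_four _ Z; exists (rho a a), (a, a).
  have [a _] := @apt_four _ Z; have [b ab] := attained a.
  by rewrite -ab; apply: ub_le_sup; [exists 1 => _ [p _ <-]; exact: le1 | exists (a, b)].
have erho : moebius_equivalent (apt_fun (a := Z)) rho.
  move=> a b c d u; rewrite (mpt_equivalent x u) /cross_ratio /rho.
  move: u; rewrite /= !inE !negb_or => /and4P[/and3P[_ ac ad] /andP[bc bd] _ _].
  have := mpt_gt0 x ad; have := mpt_gt0 x bc; rewrite !expRD => h1 h2.
  by field; rewrite !gt_eqF ?expR_gt0.
by exists (MoebiusPoint arho erho); exact: half_log_unique.
Qed.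

End MoebiusSpace.

(** * Geodesics of the Moebius space *)

Section Geodesics.
Context {R : realType} {Z : antipodalSpace R}.
Local Notation M := (moebius_space Z).
Implicit Types (x y z : M) (a b xi eta : Z) (r s t : R).

Lemma tighten_point x r (f : Z -> R) : bounded_by r f ->
  (forall a b, expR (f a + f b) * x a b <= 1) ->
  exists y, half_log x y = tighten x f.
Proof.
move=> fC f1; have xa := mpt_antipode x.
have fs a : f a <= star x f a by exact: (le1_subtight (mpt_ge0 x) (mpt_le1 x) xa fC).
apply: mpt_of_tight.
  exact: (tighten_bounded (mpt_ge0 x) (mpt_le1 x) (mpt_sym x) xa fC fs).
exact: (star_tighten (mpt_ge0 x) (mpt_le1 x) (mpt_sym x) xa fC fs).
Qed.

(** Nonexpansiveness of the retraction, in terms of the metric of [M]. *)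
Lemma mdist_tighten x y z r (f g : Z -> R) s :
  bounded_by r f -> bounded_by r g ->
  (forall a b, expR (f a + f b) * x a b <= 1) ->
  (forall a b, expR (g a + g b) * x a b <= 1) ->
  half_log x y = tighten x f -> half_log x z = tighten x g ->
  (forall a, `|f a - g a| <= s / 2) -> mdist y z <= s.
Proof.
move=> fC gC f1 g1 yf zg fg; have xa := mpt_antipode x.
apply: mdist_moebius_le => a.
rewrite (half_log_chain y x z) half_log_inv yf zg addrC distrC.
apply: (tighten_lip (mpt_ge0 x) (mpt_le1 x) (mpt_sym x) xa fC gC) => // b;
  exact: (le1_subtight (mpt_ge0 x) (mpt_le1 x) xa).
Qed.

Lemma half_log_inj x : injective (half_log x).
Proof.
move=> y z E; apply: mdist_positivity; apply/le_anti; rewrite mdist_ge0 andbT.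
apply: mdist_moebius_le => a.
by rewrite (half_log_chain y x z) half_log_inv E addNr normr0 mul0r.
Qed.

Lemma tighten_half_log x y : tighten x (half_log x y) = half_log x y.
Proof. by apply: tighten_id; exact: star_half_log. Qed.

(** Scaling an exponent towards [0] preserves the constraint, whatever its
    sign. *)
Lemma expR_scale_le1 (w L t : R) : 0 <= t <= 1 -> 0 <= L <= 1 ->
  expR w * L <= 1 -> expR (t * w) * L <= 1.
Proof.
move=> /andP[t0 t1] /andP[L0 L1] wL; case: (leP 0 w) => w0.
  by apply: le_trans wL; rewrite ler_wpM2r// ler_expR ler_piMl.
rewrite mulr_ile1 ?expR_ge0// -expR0 ler_expR.
by rewrite mulr_ge0_le0// ltW.
Qed.

(** The retraction of the affine segment from [0] to [half_log x y]: the curve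
    is 1-Lipschitz and its endpoints are at distance [r], so that no distance
    along it can be shorter than the parameter. *)
Lemma geodesic_moebius : geodesic M.
Proof.
move=> x y; set r := mdist x y; have r0 : 0 <= r by exact: mdist_ge0.
have [r00|rn0] := eqVneq r 0.
  exists (fun=> x); split=> //; last exact: mdist_positivity.
  move=> s t; rewrite r00 /= !in_itv /= => /le_anti <- /le_anti <-.
  by rewrite mdistxx subrr normr0.
have r_gt0 : 0 < r by rewrite lt_neqAle eq_sym rn0.
pose f s a := s / r * half_log x y a.
have hxy a : `|half_log x y a| <= r / 2 by exact: half_log_le.
have I01 s : s \in `[0, r] -> 0 <= s / r <= 1.
  by rewrite in_itv /= => /andP[s0 sr]; rewrite divr_ge0//= ler_pdivrMr// mul1r.
have fC s : s \in `[0, r] -> bounded_by (r / 2) (f s).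
  move=> /I01/andP[s0 s1] a; rewrite /f normrM (ger0_norm s0).
  by apply: le_trans (hxy a); rewrite ler_piMl.
have f1 s : s \in `[0, r] -> forall a b, expR (f s a + f s b) * x a b <= 1.
  move=> sI a b; rewrite /f -mulrDr; apply: expR_scale_le1; first exact: I01.
    by rewrite mpt_ge0 mpt_le1.
  by rewrite -mpt_half_log mpt_le1.
have [c cE] : {c : R -> M & forall s, s \in `[0, r] -> half_log x (c s) = tighten x (f s)}.
  apply: (@choice _ _ (fun s y => s \in `[0, r] -> half_log x y = tighten x (f s))) => s.
  case: (boolP (s \in `[0, r])) => sI; last by exists x.
  by have [z zE] := tighten_point (fC s sI) (f1 s sI); exists z.
have cM : forall s t, s \in `[0, r] -> t \in `[0, r] -> mdist (c s) (c t) <= `|s - t|.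
  move=> s t sI tI.
  apply: (mdist_tighten (fC s sI) (fC t tI) (f1 s sI) (f1 t tI) (cE s sI) (cE t tI)) => a.
  rewrite /f -mulrBl normrM -mulrBl normrM mulrAC -mulrA ler_wpM2l//.
  by rewrite normfV (ger0_norm r0) ler_pdivrMr// mulrC.
have c0 : c 0 = x.
  apply: (@half_log_inj x); rewrite cE ?in_itv/= ?lexx//.
  rewrite (_ : f 0 = half_log x x) ?tighten_half_log//.
  by apply/funext => a; rewrite /f mul0r mul0r half_log_refl.
have cr : c r = y.
  apply: (@half_log_inj x); rewrite cE ?in_itv/= ?lexx ?r0//.
  rewrite (_ : f r = half_log x y) ?tighten_half_log//.
  by apply/funext => a; rewrite /f divff ?mul1r.
have lower s t : 0 <= s -> s <= t -> t <= r -> t - s <= mdist (c s) (c t).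
  move=> s0 st tr.
  have := cM 0 s; have := cM t r; rewrite !in_itv/= !lexx r0 s0 tr.
  rewrite (le_trans st tr) (le_trans s0 st) c0 cr => /(_ isT isT) + /(_ isT isT).
  rewrite distrC sub0r normrN (ger0_norm s0) ger0_norm ?subr_ge0// => h1 h2.
  have := metric_triangle x (c s) y; have := metric_triangle (c s) (c t) y.
  by rewrite -/r; lra.
exists c; split => //= s t sI tI; apply/le_anti; rewrite cM//=.
move: sI tI; rewrite /= !in_itv/= => /andP[s0 sr] /andP[t0 tr].
case: (leP s t) => st.
  by rewrite ler0_norm ?opprB ?lower// subr_le0.
by rewrite metric_sym ger0_norm ?subr_ge0 ?lower// ltW.
Qed.

(** The curve goes straight towards [xi]. Contrary to being geodesic, this is
    preserved by concatenation. *)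
Definition directed xi (A : set R) (c : R -> M) := forall s t, A s -> A t -> s <= t ->
  mdist (c s) (c t) <= t - s /\ half_log (c s) (c t) xi = (t - s) / 2.

Lemma directed_geodesic xi A c : directed xi A c -> geodesic_on A c.
Proof.
move=> dc.
have key s t : A s -> A t -> s <= t -> mdist (c s) (c t) = t - s.
  move=> As At st; have [h1 h2] := dc s t As At st; apply/le_anti; rewrite h1 /=.
  have := half_log_le (c s) (c t) xi; rewrite h2 => /(le_trans (ler_norm _)).
  by lra.
move=> s t As At; case: (leP s t) => st.
  by rewrite ler0_norm ?opprB ?key// subr_le0.
by rewrite metric_sym ger0_norm ?subr_ge0 ?key// ltW.
Qed.

(** [half_log] at [xi] is additive along the curve and at most half of the
    distance on each piece, so equality for the whole segment forces equality
    for each piece. *)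
Lemma geodesic_directed xi (c : R -> M) s t : s <= t -> geodesic_on `[s, t] c ->
  half_log (c s) (c t) xi = (t - s) / 2 -> directed xi `[s, t] c.
Proof.
move=> st gc hst u v /=; rewrite !in_itv/= => /andP[su ut] /andP[sv vt] uv.
have cd p q : s <= p -> p <= q -> q <= t -> mdist (c p) (c q) = q - p.
  move=> sp pq qt; rewrite gc /= ?in_itv/= ?sp ?qt ?(le_trans pq qt) ?(le_trans sp pq)//.
  by rewrite ler0_norm ?opprB// subr_le0.
split; first by rewrite cd.
have le2 p q : s <= p -> p <= q -> q <= t -> half_log (c p) (c q) xi <= (q - p) / 2.
  by move=> *; rewrite -cd//; apply: le_trans (ler_norm _) _; exact: half_log_le.
have := le2 s u; have := le2 u v; have := le2 v t; move: hst.
rewrite (half_log_chain (c s) (c u) (c t)) (half_log_chain (c u) (c v) (c t)).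
by rewrite su ut sv vt uv !lexx => hst /(_ isT isT isT) h1 /(_ isT isT isT) h2
  /(_ isT isT isT) h3; lra.
Qed.

(** The retraction of the functions equal to [t / 2] at [xi] and [- t / 2]
    elsewhere. They are subtight because [x] vanishes on the diagonal and is
    at most 1, and moving [t] moves them by half as much. *)
Lemma directed_ray x xi : exists2 c : R -> M, c 0 = x & directed xi [set t | 0 <= t] c.
Proof.
pose f t a := if a == xi then t / 2 else - (t / 2).
have fC t r : 0 <= t -> t <= r -> bounded_by (r / 2) (f t).
  move=> t0 tr a; rewrite /f; case: ifP => _; rewrite ?normrN ger0_norm; lra.
have f1 t : 0 <= t -> forall a b, expR (f t a + f t b) * x a b <= 1.
  move=> t0 a b; have [->|ab] := eqVneq a b.
    by rewrite (mpt_eq0 x b b).2// mulr0.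
  rewrite mulr_ile1 ?expR_ge0 ?mpt_ge0 ?mpt_le1//.
  rewrite -expR0 ler_expR /f; case: (eqVneq a xi) => [ax|ax]; last first.
    by case: ifP => _; lra.
  by rewrite -ax eq_sym (negbTE ab) subrr.
have [c cE] : {c : R -> M & forall t, 0 <= t -> half_log x (c t) = tighten x (f t)}.
  apply: (@choice _ _ (fun t y => 0 <= t -> half_log x y = tighten x (f t))) => t.
  case: (leP 0 t) => t0; last by exists x.
  by have [y yE] := tighten_point (fC t t t0 (lexx t)) (f1 t t0); exists y.
have c0 : c 0 = x.
  apply: (@half_log_inj x); rewrite cE//.
  rewrite (_ : f 0 = half_log x x) ?tighten_half_log//.
  by apply/funext => a; rewrite /f half_log_refl mul0r oppr0; case: ifP.
have cM s t : 0 <= s -> s <= t -> mdist (c s) (c t) <= t - s.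
  move=> s0 st; have t0 := le_trans s0 st.
  apply: (mdist_tighten (fC s t s0 st) (fC t t t0 (lexx t)) (f1 s s0) (f1 t t0)
    (cE s s0) (cE t t0)) => a.
  by rewrite /f; case: ifP => _; rewrite ler_norml; lra.
have cxi t : 0 <= t -> half_log x (c t) xi = t / 2.
  move=> t0; apply/le_anti/andP; split.
    apply: le_trans (ler_norm _) (le_trans (half_log_le _ _ _) _).
    by have := cM 0 t (lexx 0) t0; rewrite c0 subr0; lra.
  rewrite cE//; apply: le_trans (_ : f t xi <= _); first by rewrite /f eqxx.
  have xa := mpt_antipode x.
  apply: (tighten_ge (mpt_ge0 x) (mpt_le1 x) (mpt_sym x) xa (fC t t t0 (lexx t))) => a.
  apply: (le1_subtight (mpt_ge0 x) (mpt_le1 x) xa (fC t t t0 (lexx t))) => b.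
  exact: f1.
exists c => // s t /= s0 t0 st; split; first exact: cM.
by rewrite (half_log_chain (c s) x (c t)) half_log_inv !cxi//; lra.
Qed.

(** Going straight towards an antipode of [xi] is going straight away from
    [xi]. *)
Lemma directed_reverse x xi eta c r : x eta xi = 1 -> c 0 = x ->
  directed eta [set t | 0 <= t] c -> directed xi [set t | t <= r] (fun t => c (r - t)).
Proof.
move=> x1 c0 dc s t /= sr tr st.
have rs : 0 <= r - s by rewrite subr_ge0.
have rt : 0 <= r - t by rewrite subr_ge0.
have ts : r - t <= r - s by rewrite lerD2l lerN2.
have [h _] := dc _ _ rt rs ts.
rewrite metric_sym; split; first by apply: le_trans h _; rewrite opprB; lra.
have key u : 0 <= u -> half_log x (c u) xi = - (u / 2).
  move=> u0; have [] := dc 0 u (lexx 0) u0 u0; rewrite c0 subr0 => hu hu2.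
  apply/le_anti/andP; split; first by rewrite -hu2 half_log_antipode_le.
  have := half_log_le x (c u) xi; rewrite ler_norml => /andP[+ _]; lra.
rewrite (half_log_chain _ x) half_log_inv !key//; lra.
Qed.

Lemma directed_glue xi A B m c1 c2 : directed xi A c1 -> directed xi B c2 ->
  A m -> B m -> c1 m = c2 m -> (forall s, A s -> s <= m) -> (forall s, B s -> m <= s) ->
  directed xi (A `|` B) (fun t => if t <= m then c1 t else c2 t).
Proof.
move=> d1 d2 Am Bm c12 Al Bg.
have AB s : (A `|` B) s -> s <= m -> A s.
  by case=> // Bs sm; rewrite (_ : s = m)//; apply/le_anti; rewrite sm Bg.
have BA s : (A `|` B) s -> m < s -> B s by case=> // /Al; rewrite leNgt => /negP.
move=> s t ABs ABt st; case: (leP t m) => tm.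
  by rewrite (le_trans st tm); apply: d1 => //; apply: AB => //; exact: le_trans tm.
have Bt := BA t ABt tm; case: (leP s m) => sm; last by apply: d2 => //; exact: BA.
have As := AB s ABs sm.
have [h1 h2] := d1 s m As Am sm; have [h3 h4] := d2 m t Bm Bt (ltW tm).
split.
  by have := metric_triangle (c1 s) (c1 m) (c2 t); rewrite {2}c12; lra.
by rewrite (half_log_chain (c1 s) (c1 m)) h2 c12 h4; lra.
Qed.

(** Choose [xi] and [eta] by [mdist_attained]. The geodesic is directed
    towards [xi], hence so is its concatenation with a ray from [c s] to [xi]
    and a reversed ray from [c r] to [eta]. *)
Lemma geodesically_complete_moebius : geodesically_complete M.
Proof.
move=> r s c rs gc.
have cd : mdist (c r) (c s) = s - r.
  rewrite gc /= ?in_itv/= ?lexx ?rs//.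
  by rewrite ler0_norm ?opprB// subr_le0.
have [xi [eta [x1 y1 hxi heta]]] := mdist_attained (c r) (c s).
have d0 : directed xi `[r, s] c by apply: geodesic_directed => //; rewrite hxi cd.
have [p p0 dp] := directed_ray (c s) xi.
have [q q0 dq] := directed_ray (c r) eta.
have {}dq := directed_reverse (r := r) (xi := xi) (etrans (mpt_sym _ _ _) x1) q0 dq.
have {}dp : directed xi [set t | s <= t] (fun t => p (t - s)).
  move=> u v /= su sv uv; have := dp (u - s) (v - s).
  rewrite /= !subr_ge0 su sv lerD2r uv => /(_ isT isT isT).
  by rewrite (_ : v - s - (u - s) = v - u)//; lra.
pose c1 t := if t <= s then c t else p (t - s).
have d1 : directed xi (`[r, s] `|` [set t | s <= t]) c1.
  apply: (directed_glue d0 dp) => //=; rewrite ?in_itv/= ?rs ?lexx ?subrr ?p0//.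
  by move=> t; rewrite in_itv/= => /andP[].
pose c2 t := if t <= r then q (r - t) else c1 t.
have d2 : directed xi ([set t | t <= r] `|` (`[r, s] `|` [set t | s <= t])) c2.
  apply: (directed_glue dq d1) => //=; rewrite ?in_itv/= ?rs ?lexx ?subrr ?q0//.
  - by left.
  - by rewrite /c1 rs.
  - by move=> t []; rewrite ?in_itv/=; [move=> /andP[] | exact: le_trans].
exists c2; split.
  apply: (@directed_geodesic xi) => u v _ _; apply: d2.
  - case: (leP u r) => ur; first by left.
    by case: (leP u s) => us; right; [left; rewrite /= in_itv/= us ltW | right; exact: ltW].
  - case: (leP v r) => vr; first by left.
    by case: (leP v s) => vs; right; [left; rewrite /= in_itv/= vs ltW | right; exact: ltW].
move=> t; rewrite in_itv/= /c2 /c1 => /andP[rt ts]; rewrite ts; case: ifP => // tr.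
by rewrite (_ : t = r) ?subrr//; apply/le_anti; rewrite rt tr.
Qed.

End Geodesics.

(** * The bordification of the Moebius space *)

Variant bordification (R : realType) (Z : antipodalSpace R) :=
  Interior of moebius_space Z | Ideal of Z.
Arguments Interior {R Z}.
Arguments Ideal {R Z}.

Section Bordification.
Context {R : realType} {Z : antipodalSpace R}.
Local Notation M := (moebius_space Z).
Local Notation K := (bordification Z).
Implicit Types (x y s : M) (a b z : Z) (u v w : K) (e : R).

(** Opaque, as the construction is the same for any point of [M]. *)
Fact basepoint : M.
Proof. exact: (MoebiusPoint (@apt_funP _ Z) (fun _ _ _ _ _ => erefl)). Qed.

Local Notation o := basepoint.

(** [expR (- (u | a))] for the Gromov product, based at [o], of [u] with the
    ideal point [a]. *)
Definition profile u a : R :=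
  match u with
  | Interior s => expR (- (half_log o s a + mdist o s / 2))
  | Ideal z => o z a
  end.

(** The functions against which profiles are maximized in [pairing_attained].
    A point at infinity only weighs its own direction. *)
Definition weight u a : R :=
  match u with
  | Interior s => expR (half_log o s a - mdist o s / 2)
  | Ideal z => (a == z)%:R
  end.

(** [expR (- (u | v))] for the Gromov product based at [o]. *)
Definition pairing u v : R :=
  match u, v with
  | Interior s, Interior t => expR ((mdist s t - mdist o s - mdist o t) / 2)
  | Ideal z, Interior s => profile (Interior s) z
  | _, Ideal z => profile u z
  end.

Lemma profile_ge0 u a : 0 <= profile u a.
Proof. by case: u => [s|z] /=; [exact: expR_ge0 | exact: mpt_ge0 o z a]. Qed.

Lemma half_log_dist_ge0 s a : 0 <= half_log o s a + mdist o s / 2.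
Proof. by have := half_log_le o s a; rewrite ler_norml; lra. Qed.

Lemma profile_le1 u a : profile u a <= 1.
Proof.
case: u => [s|z] /=; last exact: mpt_le1 o z a.
by rewrite -[leRHS]expR0 ler_expR oppr_le0; exact: half_log_dist_ge0.
Qed.

Lemma weight_ge0 u a : 0 <= weight u a.
Proof. by case: u => [s|z] /=; [exact: expR_ge0 | exact: ler0n]. Qed.

Lemma weight_le1 u a : weight u a <= 1.
Proof.
case: u => [s|z] /=; last by case: eqP.
rewrite -[leRHS]expR0 ler_expR subr_le0.
by have := half_log_le o s a; rewrite ler_norml => /andP[].
Qed.

Lemma pairing_sym u v : pairing u v = pairing v u.
Proof.
case: u => [s|z]; case: v => [t|z']; [|exact: erefl|exact: erefl|exact: mpt_sym].
by rewrite /= metric_sym addrAC.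
Qed.

Lemma pairing_Ideal u z : pairing u (Ideal z) = profile u z.
Proof. by case: u. Qed.

(** For two interior points this is [half_log s t a <= mdist s t / 2]; for an
    ideal and an interior point, it is the bound [t z a <= 1]. *)
Lemma pairing_ge u v a : profile u a * weight v a <= pairing u v.
Proof.
case: v => [t|z]; last first.
  rewrite pairing_Ideal /=; case: eqP => [->|_]; rewrite ?mulr1 ?mulr0//.
  exact: profile_ge0.
case: u => [s|z] /=.
  rewrite -expRD ler_expR; have := half_log_le s t a.
  by rewrite ler_norml (half_log_chain s o t) half_log_inv; lra.
have := mpt_le1 t z a; rewrite (mpt_half_log o t).
set p := half_log o t z; set q := half_log o t a; set r := mdist o t => h.
have -> : expR (- (p + r / 2)) = expR (- (p + q)) * expR (q - r / 2).
  by rewrite -expRD; congr expR; ring.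
rewrite ler_wpM2r ?expR_ge0// -(ler_pM2l (expR_gt0 (p + q))) -expRD subrr expR0.
exact: h.
Qed.

(** The bound of [pairing_ge] is reached at [z] if [v = Ideal z], at a maximum
    of [half_log s t] for two interior points, and at an antipode of [z] with
    respect to [t] if [u = Ideal z] and [v = Interior t]. *)
Lemma pairing_attained u v : exists a, pairing u v = profile u a * weight v a.
Proof.
case: v => [t|z]; last by exists z; rewrite pairing_Ideal /= eqxx mulr1.
case: u => [s|z] /=.
  have [a [b [_ _ ha _]]] := mdist_attained s t; exists a.
  rewrite -expRD; congr expR; move: ha.
  by rewrite (half_log_chain s o t) half_log_inv; lra.
have [a ha] := mpt_antipode t z; exists a; move: ha; rewrite (mpt_half_log o t).
set p := half_log o t z; set q := half_log o t a; set r := mdist o t => h.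
have -> : expR (- (p + r / 2)) = expR (- (p + q)) * expR (q - r / 2).
  by rewrite -expRD; congr expR; ring.
congr (_ * _); apply: (mulfI (lt0r_neq0 (expR_gt0 (p + q)))).
by rewrite -expRD subrr expR0 -h.
Qed.

Lemma pairing_ge0 u v : 0 <= pairing u v.
Proof.
have [a ->] := pairing_attained u v.
by rewrite mulr_ge0 ?profile_ge0 ?weight_ge0.
Qed.

(** For an ideal point both sides vanish, the profile being zero where the
    weight is not. *)
Lemma weight_profile u a : weight u a * profile u a = pairing u u.
Proof.
case: u => [s|z] /=.
  by rewrite -expRD mdistxx; congr expR; lra.
rewrite ((mpt_eq0 o z z).2 erefl); case: eqP => [->|]; rewrite ?mul0r//.
by rewrite ((mpt_eq0 o z z).2 erefl) mulr0.
Qed.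

Lemma weight_peak u : exists a, weight u a = 1.
Proof.
case: u => [s|z] /=; last by exists z; rewrite eqxx.
by have [a aE _] := half_log_max o s; exists a; rewrite aE subrr expR0.
Qed.

Definition dist_profile u v : R := sup (range (fun a => `|profile u a - profile v a|)).

Lemma profile_dist_le u v a : `|profile u a - profile v a| <= dist_profile u v.
Proof.
apply: ub_le_sup; last by exists a.
exists 1 => _ [b _ <-]; rewrite ler_norml.
have := profile_ge0 u b; have := profile_le1 u b.
by have := profile_ge0 v b; have := profile_le1 v b; lra.
Qed.

Lemma dist_profile_le u v e : (forall a, `|profile u a - profile v a| <= e) ->
  dist_profile u v <= e.
Proof.
move=> h; apply: ge_sup => [|_ [a _ <-]//].
by have [a _] := @apt_four _ Z; exists `|profile u a - profile v a|, a.
Qed.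

(** By the maximum formula, since weights are at most 1. *)
Lemma pairing_lip u v w : `|pairing u w - pairing v w| <= dist_profile u v.
Proof.
have key u' v' : pairing u' w - pairing v' w <= dist_profile u' v'.
  have [a ->] := pairing_attained u' w; have h := pairing_ge v' w a.
  apply: le_trans (_ : (profile u' a - profile v' a) * weight w a <= _).
    by rewrite mulrBl lerD2l lerN2.
  apply: le_trans (profile_dist_le u' v' a).
  apply: le_trans (ler_norm _) _; rewrite normrM ler_piMr//.
  by rewrite ger0_norm ?weight_ge0 ?weight_le1.
have dsym : dist_profile v u = dist_profile u v.
  by congr sup; apply: eq_imagel => a _; rewrite distrC.
by have := key u v; have := key v u; rewrite dsym ler_norml; lra.
Qed.

Lemma dist_profilexx u : dist_profile u u = 0.
Proof.
apply/le_anti/andP; split; first by apply: dist_profile_le => a; rewrite subrr normr0.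
by have [a _] := @apt_four _ Z; have := profile_dist_le u u a; rewrite subrr normr0.
Qed.

Lemma dist_profile_sym u v : dist_profile u v = dist_profile v u.
Proof. by congr sup; apply: eq_imagel => a _; rewrite distrC. Qed.

Lemma dist_profile_triangle v u w :
  dist_profile u w <= dist_profile u v + dist_profile v w.
Proof.
apply: dist_profile_le => a.
apply: le_trans (lerD (profile_dist_le u v a) (profile_dist_le v w a)).
rewrite (_ : profile u a - profile w a =
  (profile u a - profile v a) + (profile v a - profile w a)); last by ring.
exact: ler_normD.
Qed.

Lemma pairing_Ideal_gt0 s z : 0 < pairing (Interior s) (Ideal z).
Proof. exact: expR_gt0. Qed.

Lemma pairing_Ideal2_eq0 z z' : pairing (Ideal z) (Ideal z') = 0 <-> z = z'.
Proof. exact: mpt_eq0 o z z'. Qed.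

(** Points with the same profile pair equally with every point, in particular
    with themselves; and [pairing] vanishes only on the diagonal of the ideal
    points. *)
Lemma dist_profile_positivity u v : dist_profile u v = 0 -> u = v.
Proof.
move=> d0; have E w : pairing u w = pairing v w.
  by apply/eqP; rewrite -subr_eq0 -normr_le0 -d0 pairing_lip.
move: (E u) (E v).
case: u {E d0} => [s|z]; case: v => [t|z'].
- rewrite (pairing_sym (Interior t)) => E1 E2; congr Interior.
  have E3 := etrans E1 E2; move: E1 E3 => /expR_inj + /expR_inj; clear E2.
  rewrite !mdistxx => h1 h2; apply: mdist_positivity; move: h1 h2.
  by move: (mdist s t) (mdist o s) (mdist o t) => p q r h1 h2; lra.
- by move=> _; rewrite (pairing_Ideal2_eq0 z' z').2// => h;
    have := pairing_Ideal_gt0 s z'; rewrite h ltxx.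
- rewrite (pairing_Ideal2_eq0 z z).2// => h; have := pairing_Ideal_gt0 t z.
  by rewrite -h ltxx.
- by rewrite (pairing_Ideal2_eq0 z z).2// => /esym/pairing_Ideal2_eq0 ->.
Qed.

End Bordification.

HB.instance Definition _ (R : realType) (Z : antipodalSpace R) :=
  gen_eqMixin (bordification Z).
HB.instance Definition _ (R : realType) (Z : antipodalSpace R) :=
  gen_choiceMixin (bordification Z).
HB.instance Definition _ (R : realType) (Z : antipodalSpace R) :=
  isPointed.Build (bordification Z) (Interior basepoint).
HB.instance Definition _ (R : realType) (Z : antipodalSpace R) :=
  isMetric.Build R (bordification Z) (@dist_profilexx R Z)
    (@dist_profile_positivity R Z) (@dist_profile_sym R Z)
    (@dist_profile_triangle R Z).

Section BordificationTopology.
Context {R : realType} {Z : antipodalSpace R}.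
Local Notation M := (moebius_space Z).
Local Notation K := (bordification Z).
Local Notation o := (@basepoint R Z).
Implicit Types (x y s : M) (a b z : Z) (u v w : K) (e : R).

Lemma pairing_continuous : continuous (fun p : K * K => pairing p.1 p.2).
Proof.
move=> [u v]; apply/cvgrPdist_lt => e e0 /=.
have e2 : 0 < e / 2 by rewrite divr_gt0.
exists (ball u (e / 2), ball v (e / 2)); first by split; exact: nbhsx_ballx.
move=> [u' v'] /=; rewrite !ballEmdist /= => -[uu' vv'].
have -> : pairing u v - pairing u' v' =
    (pairing u v - pairing u' v) + (pairing v u' - pairing v' u').
  by rewrite (pairing_sym v) (pairing_sym v'); ring.
rewrite (le_lt_trans (ler_normD _ _))// [e]splitr ltrD//.
  exact: le_lt_trans (pairing_lip _ _ _) uu'.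
exact: le_lt_trans (pairing_lip _ _ _) vv'.
Qed.

Lemma pairingl_continuous w : continuous (pairing ^~ w).
Proof. exact: (continuous_pairl (t := w) pairing_continuous). Qed.

Lemma pairing_diag_continuous : continuous (fun u : K => pairing u u).
Proof. exact: (continuous_diag pairing_continuous). Qed.

Lemma Interior_continuous : continuous (Interior : M -> K).
Proof.
move=> s; apply/(@metricType_numDomainType.cvgrPdist_lt _ _ _ _ (nbhs_filter s)) => e e0.
near=> t; apply: le_lt_trans (_ : mdist s t < e); last first.
  have : ball s e t by near: t; exact: nbhsx_ballx.
  by rewrite ballEmdist.
apply: dist_profile_le => a /=.
apply: le_trans (ler_distN_expR (half_log_dist_ge0 _ _) (half_log_dist_ge0 _ _)) _.
have := half_log_le t s a; rewrite (half_log_chain t o s) (half_log_inv o t).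
rewrite (metric_sym t); have := metric_triangle o s t; have := metric_triangle o t s.
by rewrite (metric_sym t) !ler_norml => ? ? /andP[? ?]; lra.
Unshelve. all: by end_near. Qed.

(** The profile of an ideal point is a row of the separating function [o]. *)
Lemma Ideal_continuous : continuous (Ideal : Z -> K).
Proof.
move=> a; apply/(@metricType_numDomainType.cvgrPdist_le _ _ _ _ (nbhs_filter a)) => e e0.
have := uniformly_near (@apt_compact _ Z) (@mpt_continuous _ _ o) a e0.
by apply: filterS => a' h; apply: dist_profile_le => b /=; exact: ltW.
Qed.

(** Balls of [M] are cut out by a relation between values of [pairing] that is
    false at ideal points, where [pairing u u = 0]. Hence [M] carries the
    topology induced by the bordification, in which it is open. *)
Lemma pairing_ball s t r : (mdist s t < r) =
  (pairing (Interior t) (Interior s) ^+ 2 <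
   expR (r - mdist o s) * pairing (Interior t) (Interior t)).
Proof.
rewrite /= mdistxx expr2 -!expRD ltr_expR (metric_sym t).
by apply/idP/idP => ?; lra.
Qed.

Lemma pairing_closed_ball s t r : (mdist s t <= r) =
  (pairing (Interior t) (Interior s) ^+ 2 <=
   expR (r - mdist o s) * pairing (Interior t) (Interior t)).
Proof.
rewrite /= mdistxx expr2 -!expRD ler_expR (metric_sym t).
by apply/idP/idP => ?; lra.
Qed.

Lemma open_pairing_ball s r :
  open [set u : K | pairing u (Interior s) ^+ 2 < expR (r - mdist o s) * pairing u u].
Proof.
apply: open_lt_continuous; first exact: (continuous_sqr (@pairingl_continuous _)).
exact: continuous_scale pairing_diag_continuous.
Qed.

Lemma closed_pairing_ball s r :
  closed [set u : K | pairing u (Interior s) ^+ 2 <= expR (r - mdist o s) * pairing u u].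
Proof.
apply: closed_le_continuous; first exact: (continuous_sqr (@pairingl_continuous _)).
exact: continuous_scale pairing_diag_continuous.
Qed.

Lemma Interior_open (U : set M) :
  open U <-> exists2 V : set K, open V & U = Interior @^-1` V.
Proof.
split=> [oU|[V oV ->]]; last by apply: open_comp => // s _; exact: Interior_continuous.
pose V := \bigcup_(p in [set p : M * R | forall t, mdist p.1 t < p.2 -> U t])
  [set u : K | pairing u (Interior p.1) ^+ 2 < expR (p.2 - mdist o p.1) * pairing u u].
exists V; first by apply: bigcup_open => -[s r] _; exact: open_pairing_ball.
apply/seteqP; split=> [s Us|s [[t r] /= tU]]; last by rewrite -pairing_ball; exact: tU.
have /nbhs_ballP[r /= r0 hr] : nbhs s U by apply: open_nbhs_nbhs.
exists (s, r); first by move=> t /= st; apply: hr; rewrite ballEmdist.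
by rewrite /= -/(pairing (Interior s) (Interior s)) -pairing_ball mdistxx.
Qed.

End BordificationTopology.

Section BordificationCompact.
Context {R : realType} {Z : antipodalSpace R}.
Local Notation M := (moebius_space Z).
Local Notation K := (bordification Z).
Local Notation o := (@basepoint R Z).
Implicit Types (x y s : M) (a b z : Z) (u v w : K) (e : R).

(** The profiles form an equicontinuous family: the value of [profile u] at [a]
    is the pairing of [u] with [Ideal a], which is 1-Lipschitz in [Ideal a]. *)
Lemma near_profile a e : 0 < e ->
  \forall a' \near a, forall u, `|profile u a - profile u a'| <= e.
Proof.
move=> e0; have := uniformly_near (@apt_compact _ Z) (@mpt_continuous _ _ o) a e0.
apply: filterS => a' h u; rewrite -!pairing_Ideal 2!(pairing_sym u).
apply: le_trans (pairing_lip _ _ _) _.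
by apply: dist_profile_le => b /=; exact: ltW.
Qed.

Lemma profile_cvg_moving (F : set_system K) (f : K -> Z) b (l : R) : Filter F ->
  f @ F --> b -> profile u b @[u --> F] --> l -> profile u (f u) @[u --> F] --> l.
Proof.
move=> FF fb /cvgrPdist_le bl; apply/cvgrPdist_le => e e0.
have e2 : 0 < e / 2 by rewrite divr_gt0.
have h1 := fb _ (near_profile b e2); near=> u.
rewrite (_ : l - profile u (f u) = (l - profile u b) + (profile u b - profile u (f u)));
  last by ring.
rewrite (le_trans (ler_normD _ _))// [leRHS]splitr lerD//; first by near: u; exact: bl.
suff : forall v, `|profile v b - profile v (f u)| <= e / 2 by [].
by near: u; exact: h1.
Unshelve. all: by end_near. Qed.

(** By equicontinuity, pointwise convergence of profiles on a compact space is
    uniform. *)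
Lemma bordification_cvg (F : set_system K) v : Filter F ->
  (forall a, profile u a @[u --> F] --> profile v a) -> F --> v.
Proof.
move=> FF h; apply/metricType_numDomainType.fcvgrPdist_lt => e e0.
have e3 : 0 < e / 2 / 3 by rewrite !divr_gt0.
have cover a : [set: Z] a ->
    \forall a' \near a & u \near F, `|profile v a' - profile u a'| <= e / 2.
  move=> _; have /cvgrPdist_le /(_ _ e3) h1 := h a.
  exists ([set a' | forall u, `|profile u a - profile u a'| <= e / 2 / 3],
          [set u | `|profile v a - profile u a| <= e / 2 / 3]).
    by split => //; exact: near_profile.
  move=> [a' u] /= [ha hu]; have := ha v; have := ha u; move: hu.
  by rewrite !ler_norml; lra.
have := (compact_near_coveringP [set: Z]).1 (@apt_compact _ Z) K F
  (fun u a => `|profile v a - profile u a| <= e / 2) FF cover.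
apply: filterS => u hu; apply: le_lt_trans (_ : e / 2 < e); last by lra.
by apply: dist_profile_le => a; exact: hu.
Qed.

(** Profiles converge pointwise along an ultrafilter, say to [g]. Let [zeta u]
    be a point of weight 1 for [u], where [profile u] takes its minimum
    [pairing u u], and let [z] be its limit. If [g z = 0], then [g] is the
    profile of [z]. Otherwise [g] is bounded below by [g z], and it is the
    profile of an interior point at distance [- ln (g z)] from [o]. *)
Lemma bordification_compact : compact [set: K].
Proof.
rewrite compact_ultra => F UF _.
have I01 (t : R) : 0 <= t -> t <= 1 -> `[0, 1]%classic t.
  by move=> t0 t1; rewrite /= in_itv/= t0 t1.
have [g gE] : {g : Z -> R & forall a, profile u a @[u --> F] --> g a}.
  apply: (@choice _ _ (fun a l => profile u a @[u --> F] --> l)) => a.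
  have [|l _ hl] := ultra_cvg_compact (f := profile ^~ a) UF (@segment_compact R 0 1).
    by move=> u; apply: I01; [exact: profile_ge0 | exact: profile_le1].
  by exists l.
have [zeta zetaE] := choice (@weight_peak R Z).
have zetaP u : profile u (zeta u) = pairing u u.
  by rewrite -(weight_profile u (zeta u)) zetaE mul1r.
have [z _ zetaz] := ultra_cvg_compact (f := zeta) UF (@apt_compact _ Z) (fun=> I).
have mE : pairing u u @[u --> F] --> g z.
  rewrite (_ : (fun u => pairing u u) = (fun u => profile u (zeta u))).
    exact: profile_cvg_moving zetaz (gE z).
  by apply/funext => u; rewrite zetaP.
have zge a : o a z <= g a.
  have h : o a (zeta u) @[u --> F] --> o a z.
    by apply: (@continuous_cvg _ _ _ F _ zeta (o a)) => //; exact: mptl_continuous.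
  apply: (ler_cvg_to h (gE a)); near=> u.
  have := pairing_ge (Ideal a) u (zeta u).
  by rewrite pairing_sym pairing_Ideal zetaE mulr1.
(* [beta a u] realizes the maximum that gives [profile u a] *)
have [beta betaE] : {beta : Z -> K -> Z &
    forall a u, profile u a = o a (beta a u) * weight u (beta a u)}.
  have /choice[f fE] (p : Z * K) :
      exists b, profile p.2 p.1 = o p.1 b * weight p.2 b.
    by rewrite -pairing_Ideal pairing_sym; exact: pairing_attained (Ideal p.1) p.2.
  by exists (fun a u => f (a, u)) => a u; exact: fE (a, u).
have blim a : exists2 b, o a (beta a u) @[u --> F] --> o a b & 
    profile u (beta a u) @[u --> F] --> g b /\ o (beta a u) z @[u --> F] --> o b z.
  have [b _ hb] := ultra_cvg_compact (f := beta a) UF (@apt_compact _ Z) (fun=> I).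
  exists b; first by apply: (@continuous_cvg _ _ _ F _ (beta a) (o a)) => //; exact: mptl_continuous.
  split; first exact: profile_cvg_moving hb (gE b).
  rewrite mpt_sym (_ : (fun u => _) = (fun u => o z (beta a u))).
    by apply: (@continuous_cvg _ _ _ F _ (beta a) (o z)) => //; exact: mptl_continuous.
  by apply/funext => u; rewrite mpt_sym.
(* [b] is the limit of [beta a]; the equality is the limit of
   [profile u a * profile u b = pairing u u * o a b] at [b = beta a u] *)
have key a : exists2 b, g a * g b = g z * o a b & g a <= o a b.
  have [b h1 [h2 h3]] := blim a; exists b.
    have h4 : profile u a * profile u (beta a u) @[u --> F] --> g a * g b.
      exact: cvgM (gE a) h2.
    have h5 : profile u a * profile u (beta a u) @[u --> F] --> g z * o a b.
      suff -> : (fun u => profile u a * profile u (beta a u)) =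
                (fun u => pairing u u * o a (beta a u)) by exact: cvgM mE h1.
      apply/funext => u; rewrite -(weight_profile u (beta a u)) (betaE a u).
      by move: (o a _) (weight _ _) (profile _ _) => p q r; ring.
    exact: (cvg_unique (@Rhausdorff R) h4 h5).
  apply: (ler_cvg_to (gE a) h1); near=> u.
  by rewrite (betaE a u) ler_piMr ?mpt_ge0 ?weight_le1.
have gz_ge0 : 0 <= g z.
  by apply: le_trans (zge z); exact: mpt_ge0.
have [gz0|gz0] := eqVneq (g z) 0.
  exists (Ideal z); split=> //; apply: bordification_cvg => a.
  suff -> : profile (Ideal z) a = g a by exact: gE.
  rewrite /= mpt_sym; apply/le_anti/andP; split; first exact: zge.
  have [b] := key a; rewrite gz0 mul0r => /eqP.
  rewrite mulf_eq0 => /orP[/eqP -> _|/eqP gb0 ab]; first exact: mpt_ge0.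
  suff <- : b = z by [].
  apply/(mpt_eq0 o b z)/le_anti; rewrite mpt_ge0 andbT -gb0.
  exact: zge.
have gz_gt0 : 0 < g z by rewrite lt_neqAle eq_sym gz0.
have gge a : g z <= g a.
  apply: (ler_cvg_to mE (gE a)); near=> u.
  by rewrite -(weight_profile u a) ler_piMl ?profile_ge0 ?weight_le1.
have ggt0 a : 0 < g a by exact: lt_le_trans (gge a).
have gle1 a : g a <= 1.
  have c1 : (fun _ : K => 1 : R) @ F --> (1 : R) by exact: cvg_cst.
  by apply: (ler_cvg_to (gE a) c1); near=> u; exact: profile_le1.
(* the function whose profile is [g] for a point at distance [r] of [o] *)
pose r := - ln (g z); pose T a := - (r / 2) - ln (g a).
have lnle a : ln (g z) <= ln (g a) by rewrite ler_ln ?posrE.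
have lnle0 a : ln (g a) <= 0 by rewrite -ln1 ler_ln ?posrE.
have TC : bounded_by (r / 2) T.
  move=> a; have := lnle a; have := lnle0 a; rewrite /T /r ler_norml.
  by move: (ln (g a)) (ln (g z)) => *; lra.
have expT a b : expR (T a + T b) = g z / (g a * g b).
  rewrite -[X in X / _]lnK ?posrE// -[X in _ / X]lnK ?posrE ?mulr_gt0//.
  by rewrite -expRN -expRD lnM ?posrE// /T /r; congr expR; lra.
have T1 a b : expR (T a + T b) * o a b <= 1.
  rewrite expT mulrAC ler_pdivrMr ?mulr_gt0// mul1r.
  have h1 : pairing u u * o a b @[u --> F] --> g z * o a b.
    by apply: cvgM; [exact: mE | exact: cvg_cst].
  apply: (ler_cvg_to h1 (cvgM (gE a) (gE b))); near=> u.
  rewrite /= -(weight_profile u b) mulrAC ler_wpM2r ?profile_ge0//.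
  by rewrite mulrC -(pairing_Ideal u) pairing_sym; exact: pairing_ge (Ideal a) u b.
have TE : star o T = T.
  apply/funext => a; apply/le_anti/andP; split; last first.
    exact: (le1_subtight (mpt_ge0 o) (mpt_le1 o) (mpt_antipode o) TC).
  have [b gab _] := key a.
  have := star_le (mpt_ge0 o) (mpt_le1 o) (mpt_antipode o) a b TC.
  have oab : expR (T a + T b) * o a b = 1.
    by rewrite expT mulrAC -gab divff// mulf_neq0// gt_eqF.
  suff -> : expR (T b) * o a b = expR (- T a) by rewrite ler_expR lerN2.
  apply: (mulfI (lt0r_neq0 (expR_gt0 (T a)))).
  by rewrite mulrA -!expRD subrr expR0.
have [s sT] := mpt_of_tight TC TE.
have rs : r = mdist o s.
  have [a ha hmax] := half_log_max o s; have := hmax z; move: ha; rewrite sT.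
  have := lnle a; rewrite /T /r; move: (ln (g z)) (ln (g a)) (mdist o s) => *; lra.
exists (Interior s); split=> //; apply: bordification_cvg => a.
suff -> : profile (Interior s) a = g a by exact: gE.
rewrite /= sT -rs /T (_ : - _ = ln (g a)) ?lnK ?posrE//.
by ring.
Unshelve. all: by end_near. Qed.

End BordificationCompact.

(** * The Moebius space is a Gromov product space *)

Section MoebiusGromov.
Context {R : realType} {Z : antipodalSpace R}.
Local Notation M := (moebius_space Z).
Local Notation K := (bordification Z).
Local Notation o := (@basepoint R Z).
Implicit Types (x y s t : M) (a b z : Z) (u v w : K) (r : R).

(** A closed ball is defined by a closed condition in the bordification which
    no ideal point satisfies. *)
Lemma proper_moebius : proper_space M.
Proof.
move=> x r F PF FB.
pose C := [set u : K | pairing u (Interior x) ^+ 2 <= expR (r - mdist o x) * pairing u u].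
have BC y : mdist x y <= r <-> C (Interior y) by rewrite pairing_closed_ball; exact: iff_refl.
have FC : (Interior @ F) C by exact: (filterS (fun y => (BC y).1) FB).
have [v [_ Fv]] := @bordification_compact R Z (Interior @ F) _ (filterT : (Interior @ F) setT).
have : C v.
  by apply: (closed_pairing_ball (s := x) (r := r)) => V Vv; exact: Fv FC Vv.
case: v Fv => [s|z] Fv Cv; last first.
  move: Cv; rewrite /C /= ((mpt_eq0 o z z).2 erefl) mulr0.
  by rewrite lt_geF// exprn_gt0// expR_gt0.
exists s; split; first exact/BC.
move=> P U FP; rewrite nbhsE => -[U' [/Interior_open[V oV ->] Vs] U'U].
have [_ [[t Pt <-] Vt]] : (Interior @` P) `&` V !=set0.
  apply: Fv; last by apply: open_nbhs_nbhs.
  suff : F (Interior @^-1` (Interior @` P)) by [].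
  by apply: filterS FP => t Pt; exists t.
by exists t; split => //; exact: U'U.
Qed.

(** On the complement of a neighbourhood of [Ideal z], pairing with [Ideal z]
    is bounded below by a positive constant; along a ray directed to [z] it
    tends to 0. *)
Lemma Interior_dense : dense (range (Interior : M -> K)).
Proof.
move=> O [u Ou] oO; apply: contrapT => h.
have OI s : ~ O (Interior s) by move=> Os; apply: h; exists (Interior s); split => //; exists s.
case: u Ou => [s|z] Ou; first exact: OI Ou.
have cO : compact (~` O).
  by apply: (subclosed_compact _ bordification_compact) => //; exact: open_closedC.
have [|v + vmin] := compact_EVT_min _ cO
  (continuous_subspaceT (pairingl_continuous (w := Ideal z))).
  by exists (Interior o); exact: OI.
rewrite inE => Ov; have v0 : 0 < pairing v (Ideal z).
  rewrite lt_neqAle pairing_ge0 andbT eq_sym; apply/eqP.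
  case: v Ov {vmin} => [s|z'] Ov; first by move=> h0; have := pairing_Ideal_gt0 s z; rewrite h0 ltxx.
  by move=> /pairing_Ideal2_eq0 E; apply: Ov; rewrite E.
have [c c0 dc] := directed_ray o z.
pose t := 1 - ln (pairing v (Ideal z)).
have t0 : 0 <= t.
  rewrite subr_ge0; apply: le_trans (_ : ln 1 <= 1); last by rewrite ln1.
  by rewrite ler_ln ?posrE// pairing_Ideal profile_le1.
have [ct1 ct2] := dc 0 t (lexx 0) t0 t0.
have dt : mdist o (c t) = t.
  rewrite c0 subr0 in ct1 ct2; apply/le_anti; rewrite ct1/=.
  by have := half_log_le o (c t) z; rewrite ct2 => /(le_trans (ler_norm _)); lra.
have : pairing v (Ideal z) <= pairing (Interior (c t)) (Ideal z).
  by apply: vmin; rewrite inE; exact: OI.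
rewrite /= -[leLHS]lnK ?posrE// ler_expR.
by move: ct2; rewrite c0 subr0 dt => ->; rewrite /t; lra.
Qed.

Lemma Interior_inj : injective (Interior : M -> K).
Proof. by move=> s t []. Qed.

Definition moebius_compactification : compactification M :=
  Compactification (@bordification_compact R Z) (@metric_hausdorff R K)
    Interior_inj Interior_open Interior_dense.

Local Notation KM := moebius_compactification.

(** [expR (- (u | v)_x)], written in terms of products based at [o]. *)
Definition based_pairing x u v : R :=
  pairing u v / (pairing u (Interior x) * pairing v (Interior x)) * expR (- mdist o x).

Lemma pairing_Interior_gt0 u x : 0 < pairing u (Interior x).
Proof. by case: u => *; exact: expR_gt0. Qed.

Lemma based_pairing_ge0 x u v : 0 <= based_pairing x u v.
Proof.
rewrite mulr_ge0 ?expR_ge0// divr_ge0 ?pairing_ge0//.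
by rewrite mulr_ge0 ?pairing_ge0.
Qed.

(** If [a] realizes the maximum defining [pairing u v], then it is a candidate
    in the maxima defining [pairing u (Interior x)] and [pairing (Interior x) v].
    The factor [expR (- mdist o x)] is [pairing (Interior x) (Interior x)]. *)
Lemma based_pairing_le1 x u v : based_pairing x u v <= 1.
Proof.
rewrite /based_pairing mulrAC ler_pdivrMr ?mulr_gt0 ?pairing_Interior_gt0// mul1r.
have -> : expR (- mdist o x) = pairing (Interior x) (Interior x).
  by rewrite /= mdistxx; congr expR; lra.
have [a ->] := pairing_attained u v; rewrite -(weight_profile _ a).
rewrite (pairing_sym v) mulrACA [leLHS]mulrACA.
rewrite (_ : _ * _ * (_ * _) = (profile u a * weight (Interior x) a) *
   (profile (Interior x) a * weight v a)); last by ring.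
apply: ler_pM; rewrite ?mulr_ge0 ?profile_ge0 ?weight_ge0//; exact: pairing_ge.
Qed.

Lemma based_pairing_continuous x :
  continuous (fun p : K * K => based_pairing x p.1 p.2).
Proof.
have c1 := @continuous_fst_comp K K _ _ (pairingl_continuous (w := Interior x)).
have c2 := @continuous_snd_comp K K _ _ (pairingl_continuous (w := Interior x)).
have c3 : continuous (fun p : K * K =>
    (pairing p.1 (Interior x) * pairing p.2 (Interior x))^-1).
  apply: continuous_inv; first exact: continuous_mul.
  by move=> p; rewrite mulr_gt0 ?pairing_Interior_gt0.
apply: continuous_mul => [|p]; last exact: cvg_cst.
by apply: continuous_mul => //; exact: pairing_continuous.
Qed.

Lemma based_pairing_Interior x s t :
  based_pairing x (Interior s) (Interior t) = expR (- gromov_product x s t).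
Proof.
rewrite /based_pairing /= -[X in _ / X]expRD -expRN -!expRD; apply: (congr1 expR).
rewrite /gromov_product (metric_sym x s) (metric_sym x t).
move: (mdist s t) (mdist s x) (mdist t x) (mdist o s) (mdist o t) (mdist o x).
by move=> *; lra.
Qed.

Lemma based_pairing_Ideal x a b : based_pairing x (Ideal a) (Ideal b) = x a b.
Proof.
rewrite /based_pairing /= (mpt_half_log o x) -expRD -expRN mulrAC -mulrA -expRD.
by rewrite mulrC; congr (_ * _); apply: (congr1 expR); lra.
Qed.

Lemma boundary_Ideal u : boundary KM u -> exists z, u = Ideal z.
Proof. by case: u => [s|z] h; [case: h; exists s | exists z]. Qed.

Lemma Ideal_boundary z : boundary KM (Ideal z).
Proof. by move=> [s _]. Qed.

(** The boundary product of two ideal points is [- ln (x z z')]. *)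
Lemma gp_moebius_compactification : gp_compactification KM.
Proof.
split; first exact: compact_second_countable (@bordification_compact R Z).
move=> x; exists (fun p => neglog (based_pairing x p.1 p.2)); first split.
- move=> p; apply: (@continuous_comp _ _ _ (fun p : K * K => based_pairing x p.1 p.2) neglog).
    exact: based_pairing_continuous.
  exact: neglog_continuous.
- by move=> p; apply: neglog_ge0; exact: based_pairing_le1.
- by move=> y z; rewrite /= based_pairing_Interior neglog_expR opprK.
move=> xi eta.
have [z zE] := boundary_Ideal (set_mem (valP xi)).
have [z' z'E] := boundary_Ideal (set_mem (valP eta)).
rewrite /= neglog_eqy ?based_pairing_ge0// zE z'E based_pairing_Ideal mpt_eq0.
split=> [zz'|/(congr1 \val)]; last by rewrite zE z'E => -[].
by apply: val_inj; rewrite /= zE z'E zz'.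
Qed.

Definition ideal_boundary z : boundary KM :=
  exist _ (Ideal z : KM) (mem_set (@Ideal_boundary z)).

Lemma four_points_boundary : at_least_four_points (boundary KM).
Proof.
have [a [b [c [d u]]]] := @apt_four _ Z.
exists (ideal_boundary a), (ideal_boundary b), (ideal_boundary c), (ideal_boundary d).
rewrite -(map_inj_uniq (f := ideal_boundary)) in u => //.
by move=> z z' /(congr1 \val)[].
Qed.

Lemma gromov_product_space_moebius : gromov_product_space M.
Proof.
split; [exact: proper_moebius | exact: geodesic_moebius |
  exact: geodesically_complete_moebius |].
by exists KM; [exact: gp_moebius_compactification | exact: four_points_boundary].
Qed.

End MoebiusGromov.

(** * Gromov product compactifications *)

Section GromovCompactification.
Context {R : realType} {X : metricType R}.
Implicit Types (K : compactification X) (x y z : X).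

(** [expR (- (u | v)_x)] on the whole compactification; on the boundary, this
    is [boundary_rho]. *)
Definition visual K x (u v : K) : R := expN (boundary_product x (u, v)).

Lemma gromov_extension_expN K x (g : K * K -> \bar R) : gromov_extension x g ->
  continuous (fun p => expN (g p)) /\
  forall y z, expN (g (cpt_emb K y, cpt_emb K z)) = expR (- gromov_product x y z).
Proof.
move=> [cg g0 gE]; split=> [p|y z]; last by rewrite gE.
apply: (@continuous_comp _ _ _ g expN); first exact: cg.
exact: expN_continuous_at.
Qed.

Lemma expN_extension_unique K (f g : K * K -> R) :
  continuous f -> continuous g ->
  (forall y z, f (cpt_emb K y, cpt_emb K z) = g (cpt_emb K y, cpt_emb K z)) ->
  f = g.
Proof.
move=> cf cg fg; apply/funext.
apply: (@dense_closed_ind2 _ _ K K [set p | f p = g p]); last exact: fg.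
exact: closed_eq_continuous.
Qed.

Lemma gromov_extension_unique K x (g h : K * K -> \bar R) :
  gromov_extension x g -> gromov_extension x h -> g = h.
Proof.
move=> Eg Eh; have [cg ge] := gromov_extension_expN Eg.
have [ch he] := gromov_extension_expN Eh.
have E := expN_extension_unique cg ch (fun y z => etrans (ge y z) (esym (he y z))).
have [_ g0 _] := Eg; have [_ h0 _] := Eh.
by apply/funext => p; apply: expN_inj => //; exact: (congr1 (@^~ p) E).
Qed.

Section Visual.
Variable K : compactification X.
Hypothesis gK : gp_compactification K.
Local Notation emb := (cpt_emb K).
Implicit Types (u v w : K).

Lemma boundary_productP x : gromov_extension x (@boundary_product _ _ K x).
Proof. by have [g Eg _] := gK.2 x; exact: (getPex (ex_intro _ g Eg)). Qed.

Lemma visual_continuous x : continuous (fun p : K * K => visual x p.1 p.2).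
Proof.
have [h _] := gromov_extension_expN (boundary_productP x).
by rewrite (_ : (fun p => _) = (fun p => expN (boundary_product x p)))//;
   apply/funext => -[].
Qed.

Lemma visual_emb x y z : visual x (emb y) (emb z) = expR (- gromov_product x y z).
Proof. by have [_] := gromov_extension_expN (boundary_productP x); exact. Qed.

Lemma visual_ge0 x u v : 0 <= visual x u v.
Proof. exact: expN_ge0. Qed.

Lemma visual_le1 x u v : visual x u v <= 1.
Proof. by have [_ h _] := boundary_productP x; exact: expN_le1. Qed.

Lemma visualr_continuous x u : continuous (visual x u).
Proof. exact: (continuous_pairr (s := u) (@visual_continuous x)). Qed.

Lemma visuall_continuous x v : continuous (fun u => visual x u v).
Proof. exact: (continuous_pairl (t := v) (@visual_continuous x)). Qed.

Lemma visual_diag_continuous x : continuous (fun u : K => visual x u u).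
Proof. exact: (continuous_diag (@visual_continuous x)). Qed.

Lemma visual_unique x (f : K * K -> R) : continuous f ->
  (forall y z, f (emb y, emb z) = expR (- gromov_product x y z)) ->
  forall u v, visual x u v = f (u, v).
Proof.
move=> cf fE u v.
suff : (fun p => visual x p.1 p.2) = f by move/(congr1 (@^~ (u, v))).
apply: expN_extension_unique => [|//|y z /=]; first exact: visual_continuous.
by rewrite visual_emb fE.
Qed.

Lemma visual_sym x u v : visual x u v = visual x v u.
Proof.
apply: (@dense_closed_ind2 _ _ K K [set p | visual x p.1 p.2 = visual x p.2 p.1] _ _ (u, v)).
  apply: closed_eq_continuous; first exact: visual_continuous.
  move=> p; apply: (@continuous_comp _ _ _ (fun p => (p.2, p.1))
    (fun p => visual x p.1 p.2)).
    by apply: cvg_pair; [exact: cvg_snd | exact: cvg_fst].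
  exact: visual_continuous.
move=> y z /=; rewrite !visual_emb /gromov_product (metric_sym z y).
by apply: (congr1 expR); lra.
Qed.

Lemma visual_eq0 x (xi eta : boundary K) :
  visual x (\val xi) (\val eta) = 0 <-> xi = eta.
Proof.
have [g Eg gy] := gK.2 x; rewrite -gy (gromov_extension_unique Eg (boundary_productP x)).
by have [_ h _] := boundary_productP x; exact: expN_eq0.
Qed.

Lemma visual_emb_diag x y : visual x (emb y) (emb y) = expR (- mdist x y).
Proof.
by rewrite visual_emb /gromov_product mdistxx; apply: (congr1 expR); lra.
Qed.

Lemma visual_emb_base x y z :
  visual x (emb y) (emb z) = expR (- ((mdist x y + mdist x z - mdist y z) / 2)).
Proof. exact: visual_emb. Qed.

(** For a point [y] of [X] the value is [expR (- mdist x y)]. *)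
Lemma visual_diag_eq0 x u : visual x u u = 0 <-> boundary K u.
Proof.
split=> [u0 [y _ yu]|bu].
  by have := expR_gt0 (- mdist x y); rewrite -visual_emb_diag yu u0 ltxx.
pose xi : boundary K := exist _ u (mem_set bu).
by have [_] := visual_eq0 x xi xi; exact.
Qed.

Lemma visual_emb_ge x y u : expR (- mdist x y) <= visual x u (emb y).
Proof.
apply: (@dense_closed_ind _ K [set u | expR (- mdist x y) <= visual x u (emb y)]).
  apply: closed_le_continuous; last exact: visuall_continuous.
  by move=> v; exact: cvg_cst.
move=> z /=; rewrite visual_emb_base ler_expR lerN2.
by have := metric_triangle x y z; rewrite (metric_sym y z); lra.
Qed.

Lemma visual_emb_gt0 x y u : 0 < visual x u (emb y).
Proof. exact: lt_le_trans (expR_gt0 _) (visual_emb_ge _ _ _). Qed.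

(** The rule for changing the base point of a Gromov product, an identity
    between distances when [u] and [v] are in [X]. *)
Lemma visual_change x y u v :
  visual y u v * (visual x u (emb y) * visual x v (emb y)) =
  visual x u v * expR (- mdist x y).
Proof.
apply: (@dense_closed_ind2 _ _ K K [set p | visual y p.1 p.2 *
    (visual x p.1 (emb y) * visual x p.2 (emb y)) =
    visual x p.1 p.2 * expR (- mdist x y)] _ _ (u, v)).
  have cl := @visuall_continuous x (emb y).
  apply: closed_eq_continuous.
    apply: continuous_mul; first exact: visual_continuous.
    apply: continuous_mul; first exact: continuous_fst_comp cl.
    exact: continuous_snd_comp cl.
  apply: continuous_mul; first exact: visual_continuous.
  by move=> p; exact: cvg_cst.
move=> z w /=; rewrite !visual_emb_base -!expRD; apply: (congr1 expR).
rewrite (metric_sym y z) (metric_sym y w).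
move: (mdist x z) (mdist x w) (mdist x y) (mdist z y) (mdist w y) (mdist z w).
by move=> *; lra.
Qed.

(** By density the two points pair equally with all points, in particular with
    themselves. So both are in [X], where the Gromov product determines the
    distance, or both are at infinity and then [visual x u v = 0]. *)
Lemma visual_separates x u v :
  (forall y, visual x u (emb y) = visual x v (emb y)) -> u = v.
Proof.
move=> uv; have E w : visual x u w = visual x v w.
  apply: (@dense_closed_ind _ K [set w | visual x u w = visual x v w]) => //.
  by apply: closed_eq_continuous; exact: visualr_continuous.
have Euv : visual x u u = visual x v v by rewrite E visual_sym E.
have [u0|u0] := eqVneq (visual x u u) 0.
  have bu := (visual_diag_eq0 x u).1 u0.
  have bv : boundary K v by apply/(visual_diag_eq0 x); rewrite -Euv.
  pose xi : boundary K := exist _ u (mem_set bu).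
  pose eta : boundary K := exist _ v (mem_set bv).
  suff : xi = eta by move/(congr1 \val).
  by apply/(visual_eq0 x); rewrite /= E -Euv.
have inside w : visual x w w <> 0 -> exists y, emb y = w.
  by move=> w0; apply: contrapT => h; apply: w0; apply/visual_diag_eq0 => -[y _ yw];
    apply: h; exists y.
have [y yu] := inside u (fun h => negP u0 (introT eqP h)).
have [z zv] : exists z, emb z = v by apply: inside; rewrite -Euv; apply/eqP.
have h1 := E u; have h2 := E v; move: h1 h2; clear E Euv u0 uv.
rewrite -yu -zv !visual_emb_base !mdistxx => /expR_inj h1 /expR_inj h2.
apply: (congr1 emb); apply: mdist_positivity; move: h1 h2; rewrite (metric_sym z y).
by move: (mdist x y) (mdist x z) (mdist y z) => *; lra.
Qed.

Section Geodesics.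
Hypothesis gX : geodesic X.
Hypothesis gcX : geodesically_complete X.

Lemma point_beyond x y (r : R) : 0 <= r ->
  exists z, mdist x z = r /\ mdist y z = mdist x y + r.
Proof.
move=> r0; have [c [gc c0 cd]] := gX x y.
have [c' [gc' cc']] := gcX (mdist_ge0 x y) gc.
have c'0 : c' 0 = x by rewrite cc' ?c0// in_itv/= lexx mdist_ge0.
have c'd : c' (mdist x y) = y by rewrite cc' ?cd// in_itv/= lexx mdist_ge0.
exists (c' (- r)); rewrite -{1}c'0 -{1}c'd !gc'//.
by rewrite !opprK add0r !ger0_norm ?addr_ge0 ?mdist_ge0.
Qed.

(** For [u] in [X], prolonging a geodesic from [u] to [x] beyond [x] yields
    points [v] with [(u | v)_x = 0] at any distance from [x]. For each bound on
    [visual x v v] this is a closed condition on [(u, v)], so it holds for all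
    [u] in [K]. A minimum of [visual x v v] over the [v] with
    [visual x u v = 1] is therefore 0, and lies at infinity. *)
Lemma boundary_antipode x u : exists2 v, boundary K v & visual x u v = 1.
Proof.
have far n : exists v, visual x u v = 1 /\ visual x v v <= expR (- n%:R).
  pose C := [set p : K * K | visual x p.1 p.2 = 1] `&`
            [set p : K * K | visual x p.2 p.2 <= expR (- n%:R)].
  have cC : closed C.
    apply: closedI.
      apply: closed_eq_continuous; first exact: visual_continuous.
      by move=> p; exact: cvg_cst.
    apply: closed_le_continuous; last by move=> p; exact: cvg_cst.
    exact: continuous_snd_comp (@visual_diag_continuous x).
  apply: (dense_closed_ind (closed_proj (@cpt_compact _ K) cC)) => y /=.
  have [z [xz yz]] := point_beyond x y (ler0n R n).
  exists (emb z); split; rewrite /= ?visual_emb_diag ?xz//.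
  rewrite visual_emb_base yz xz -[RHS]expR0; apply: (congr1 expR).
  by move: (mdist x y) => *; lra.
have cA : compact [set v | visual x u v = 1].
  apply: (subclosed_compact _ (@cpt_compact _ K)) => //.
  apply: closed_eq_continuous; first exact: visualr_continuous.
  by move=> p; exact: cvg_cst.
have [|v + vmin] := compact_EVT_min _ cA
  (continuous_subspaceT (@visual_diag_continuous x)).
  by have [v [? _]] := far 0%N; exists v.
rewrite inE /= => uv; exists v => //; apply/(visual_diag_eq0 x)/le_anti.
rewrite visual_ge0 andbT; apply/ler_addgt0Pr => e e0; rewrite add0r.
have [w [uw ww]] := far (Num.truncn (- ln e)).+1.
apply: le_trans (vmin w _) _; first by rewrite inE.
apply: le_trans ww _; rewrite -[leRHS]lnK ?posrE// ler_expR lerNl ltW//.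
exact: truncnS_gt.
Qed.

(** The delicate case is that of two points [p] and [q] of [X]. By
    [visual_change] and the hypothesis, [visual q p w] has the same value for
    all [w] at infinity. It is 1 at an antipode, and equating the constant
    with 1 gives [d x p = d x q + d q p]. Exchanging [p] and [q] gives [d p q = 0]. *)
Lemma boundary_separates x u v :
  (forall xi : boundary K, visual x u (\val xi) = visual x v (\val xi)) -> u = v.
Proof.
move=> uv; have E w : boundary K w -> visual x u w = visual x v w.
  by move=> bw; have := uv (exist _ w (mem_set bw)).
have bdE w w' : (forall a, boundary K a -> visual x w a = visual x w' a) ->
    boundary K w -> boundary K w' -> w = w'.
  move=> ww' bw bw'.
  suff : exist _ w (mem_set bw) = exist _ w' (mem_set bw') :> boundary K by case.
  apply/(visual_eq0 x) => /=; rewrite (ww' _ bw').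
  exact/visual_diag_eq0.
have bdI y w : (forall a, boundary K a -> visual x (emb y) a = visual x w a) ->
    ~ boundary K w.
  move=> yw bw; have := visual_emb_gt0 x y w.
  by rewrite visual_sym (yw _ bw) ((visual_diag_eq0 x w).2 bw) ltxx.
have [bu|/contrapT[y _ yu]] := pselect (boundary K u).
  have [bv|/contrapT[z _ zv]] := pselect (boundary K v); first exact: bdE.
  by case: (@bdI z u) => // w /E; rewrite zv.
have [bv|/contrapT[z _ zv]] := pselect (boundary K v).
  by case: (@bdI y v) => // w /E; rewrite yu.
have key p q : (forall w, boundary K w -> visual x (emb p) w = visual x (emb q) w) ->
    mdist x q + mdist p q = mdist x p.
  move=> pq; have [w bw w1] := boundary_antipode q (emb p).
  have := visual_change x q (emb p) w.
  rewrite w1 mul1r (visual_sym x w) -(pq w bw) mulrC.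
  have n0 : visual x (emb p) w != 0 by rewrite visual_sym gt_eqF ?visual_emb_gt0.
  move=> /(mulfI n0); rewrite visual_emb_base => /expR_inj.
  by move: (mdist x q) (mdist x p) (mdist p q) => *; lra.
have := key y z; have := key z y; rewrite yu zv => /(_ (fun w h => esym (E w h))) h1 /(_ E) h2.
apply: (etrans (esym yu)); rewrite -zv; apply: (congr1 emb).
apply: mdist_positivity; move: h1 h2; rewrite (metric_sym z y).
by move: (mdist x y) (mdist x z) (mdist y z) => *; lra.
Qed.

End Geodesics.
End Visual.
End GromovCompactification.

(** * Boundaries as antipodal spaces, and isometric embeddings *)

Lemma boundary_rhoE (R : realType) (X : metricType R) (K : compactification X) (x : X)
    (xi eta : boundary K) : boundary_rho x xi eta = visual x (\val xi) (\val eta).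
Proof. by []. Qed.

Section Embedding.
Context {R : realType} {X : metricType R} (K : compactification X).
Hypothesis gK : gp_compactification K.
Hypothesis gX : geodesic X.
Hypothesis gcX : geodesically_complete X.
Context {Z : antipodalSpace R} (psi : Z -> boundary K) (phi : boundary K -> Z).
Hypothesis psi_continuous : continuous psi.
Hypothesis psiK : cancel psi phi.
Hypothesis phiK : cancel phi psi.
Local Notation emb := (cpt_emb K).
Implicit Types (x y : X) (a b : Z).

Definition pullback x a b : R := boundary_rho x (psi a) (psi b).

Lemma pullback_continuous x : continuous (fun p : Z * Z => pullback x p.1 p.2).
Proof.
have cpsi : continuous (\val \o psi).
  move=> a; apply: continuous_comp; first exact: psi_continuous.
  exact: boundary_val_continuous.
exact: (continuous_pair_comp cpsi cpsi (@visual_continuous _ _ _ gK x)).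
Qed.

(** Antipodes come from [boundary_antipode], that is from geodesic
    completeness. *)
Lemma pullback_antipodal x : antipodal (pullback x).
Proof.
have le1 a b : pullback x a b <= 1 by exact: (visual_le1 gK).
have anti a : exists b, pullback x a b = 1.
  have [v bv v1] := boundary_antipode gK gX gcX x (\val (psi a)).
  exists (phi (exist _ v (mem_set bv))); rewrite /pullback phiK.
  exact: v1.
split=> //.
  split=> [|a b|a b|a b]; first exact: pullback_continuous.
  - exact: visual_ge0.
  - exact: (visual_sym gK).
  - split=> [/(visual_eq0 gK)/(can_inj psiK)//|->].
    exact/(visual_eq0 gK).
have [a _] := @apt_four _ Z; have [b ab] := anti a.
apply/le_anti/andP; split.
  by apply: ge_sup => [|_ [p _ <-]]; [exists (pullback x a a), (a, a) | exact: le1].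
by rewrite -ab; apply: ub_le_sup; [exists 1 => _ [p _ <-]; exact: le1 | exists (a, b)].
Qed.

(** The logarithmic derivative of [rho_y] with respect to [rho_x] is a Busemann
    function, [2 * (a | y)_x - d x y]; this is [visual_change] on the
    boundary. *)
Lemma half_log_pullback (s t : moebius_space Z) x y a :
  mpt_fun s = pullback x -> mpt_fun t = pullback y ->
  half_log s t a = - ln (visual x (\val (psi a)) (emb y)) - mdist x y / 2.
Proof.
move=> sx ty; pose g a := - ln (visual x (\val (psi a)) (emb y)) - mdist x y / 2.
rewrite -/(g a) (@half_log_unique _ _ s t g)//.
  move=> b; apply: cvgB; last exact: cvg_cst.
  apply: cvgN; apply: continuous_cvg.
    by apply: continuous_ln; exact: (visual_emb_gt0 gK).
  apply: (@continuous_comp _ _ _ (\val \o psi) (fun u => visual x u (emb y))).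
    apply: continuous_comp; first exact: psi_continuous.
    exact: boundary_val_continuous.
  exact: (visuall_continuous gK).
move=> b c; rewrite sx ty /pullback !boundary_rhoE /g.
have := visual_change gK x y (\val (psi b)) (\val (psi c)).
have := visual_emb_gt0 gK x y (\val (psi b)); have := visual_emb_gt0 gK x y (\val (psi c)).
set p := visual x _ (emb y); set q := visual x _ (emb y) => p0 q0 E.
have -> : - ln q - mdist x y / 2 + (- ln p - mdist x y / 2) =
  - (ln q + ln p) - mdist x y by lra.
rewrite -lnM ?posrE// expRD expRN lnK ?posrE ?mulr_gt0// -mulrA [X in _ * X]mulrC -E.
by rewrite mulrCA mulVf ?mulr1// gt_eqF ?mulr_gt0.
Qed.

(** The half logarithm [(a | y)_x - d x y / 2] lies between [- d x y / 2] and
    [d x y / 2] and reaches its lower bound at an antipode of [y] with respect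
    to [x]. *)
Lemma mdist_pullback (s t : moebius_space Z) x y :
  mpt_fun s = pullback x -> mpt_fun t = pullback y -> mdist s t = mdist x y.
Proof.
move=> sx ty; have hE a := half_log_pullback a sx ty.
apply/le_anti/andP; split.
  apply: mdist_moebius_le => a; rewrite hE ler_norml.
  have v0 := visual_emb_gt0 gK x y (\val (psi a)).
  have h1 : ln (visual x (\val (psi a)) (emb y)) <= 0.
    by rewrite -ln1 ler_ln ?posrE//; exact: (visual_le1 gK).
  have h2 : - mdist x y <= ln (visual x (\val (psi a)) (emb y)).
    by rewrite -ler_expR lnK ?posrE//; exact: (visual_emb_ge gK).
  by move: h1 h2; move: (ln _) (mdist x y) => *; lra.
have [v bv v1] := boundary_antipode gK gX gcX x (emb y).
have := half_log_le s t (phi (exist _ v (mem_set bv))).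
rewrite hE phiK /= (visual_sym gK) v1 ln1 oppr0 sub0r normrN.
by rewrite ger0_norm ?divr_ge0 ?mdist_ge0// ler_pM2r.
Qed.

End Embedding.

(** * Comparison of compactifications, filling and maximality *)

(** Relate [u] in [K] to [v] in [L] when they have the same Gromov products
    with all points of [X]. This closed relation contains the pairs of images
    of points of [X], and it is functional since these products separate the
    points of [L]. *)
Lemma gp_comparison (R : realType) (X : metricType R) (K L : compactification X) (x : X) :
  gp_compactification K -> gp_compactification L ->
  exists2 Phi : K -> L, continuous Phi & forall y, Phi (cpt_emb K y) = cpt_emb L y.
Proof.
move=> gK gL.
pose C := \bigcap_y [set p : K * L |
  visual x p.1 (cpt_emb K y) = visual x p.2 (cpt_emb L y)].
have cC : closed C.
  apply: closed_bigI => y _; apply: closed_eq_continuous.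
    exact: (@continuous_fst_comp K L _ _ (@visuall_continuous _ _ _ gK x (cpt_emb K y))).
  exact: (@continuous_snd_comp K L _ _ (@visuall_continuous _ _ _ gL x (cpt_emb L y))).
have C_emb y : C (cpt_emb K y, cpt_emb L y).
  by move=> z _ /=; rewrite !visual_emb.
have C_unique u v w : C (u, v) -> C (u, w) -> v = w.
  move=> uv uw; apply: (visual_separates gL (x := x)) => y.
  exact: etrans (esym (uv y I)) (uw y I).
have C_ex u : exists v, C (u, v).
  apply: (dense_closed_ind (closed_proj (@cpt_compact _ L) cC)) => y.
  by exists (cpt_emb L y).
have [Phi PhiE] := choice C_ex.
exists Phi; last by move=> y; exact: C_unique (PhiE _) (C_emb y).
apply: (continuous_closed_graph (@cpt_compact _ L) cC PhiE) => u v uv.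
exact: C_unique uv (PhiE u).
Qed.

Lemma visual_comparison (R : realType) (X : metricType R) (K L : compactification X)
    (Phi : K -> L) : gp_compactification K -> gp_compactification L -> continuous Phi ->
  (forall y, Phi (cpt_emb K y) = cpt_emb L y) ->
  forall x u v, visual x u v = visual x (Phi u) (Phi v).
Proof.
move=> gK gL cPhi PhiE x u v.
apply: (visual_unique gK (f := fun p => visual x (Phi p.1) (Phi p.2))).
  exact: (continuous_pair_comp cPhi cPhi (@visual_continuous _ _ _ gL x)).
by move=> y z /=; rewrite !PhiE visual_emb.
Qed.

Lemma comparison_cancel (R : realType) (X : metricType R) (K L : compactification X)
    (Phi : K -> L) (Psi : L -> K) : gp_compactification K -> gp_compactification L ->
  continuous Phi -> continuous Psi ->
  (forall y, Phi (cpt_emb K y) = cpt_emb L y) ->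
  (forall y, Psi (cpt_emb L y) = cpt_emb K y) -> forall x : X, cancel Phi Psi.
Proof.
move=> gK gL cPhi cPsi PhiE PsiE x u; apply: (visual_separates gK (x := x)) => y.
rewrite -PsiE -(visual_comparison gL gK cPsi PsiE) (visual_comparison gK gL cPhi PhiE).
by rewrite PsiE PhiE.
Qed.

Section Filling.
Context {R : realType} {Z : antipodalSpace R}.
Local Notation M := (moebius_space Z).
Local Notation KM := (@moebius_compactification R Z).

Lemma visual_moebius (x : M) (u v : KM) : visual x u v = based_pairing x u v.
Proof.
apply: (visual_unique gp_moebius_compactification
  (f := fun p : KM * KM => based_pairing x p.1 p.2)).
  exact: based_pairing_continuous.
by move=> y z; exact: based_pairing_Interior.
Qed.

(** Compare [K] with the bordification. The identification of the boundary of
    the latter with [Z] has a continuous inverse because [Ideal z] is the only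
    point whose pairing with [Ideal z] vanishes. *)
Lemma boundary_moebius (K : compactification M) : gp_compactification K ->
  exists (phi : boundary K -> Z) (psi : Z -> boundary K),
    [/\ continuous phi, continuous psi, cancel phi psi, cancel psi phi &
     forall (x : M) xi eta, boundary_rho x xi eta = x (phi xi) (phi eta)].
Proof.
move=> gK; have gM := @gp_moebius_compactification R Z; pose o := @basepoint R Z.
have [Phi cPhi PhiE] := gp_comparison o gK gM.
have [Psi cPsi PsiE] := gp_comparison o gM gK.
have PhiK := comparison_cancel gK gM cPhi cPsi PhiE PsiE o.
have PsiK := comparison_cancel gM gK cPsi cPhi PsiE PhiE o.
have visE := visual_comparison gK gM cPhi PhiE.
have phi_ex (xi : boundary K) : exists z, Phi (\val xi) = Ideal z.
  apply: boundary_Ideal; apply/(visual_diag_eq0 gM o); rewrite -visE; apply/(visual_diag_eq0 gK o).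
  exact: set_mem (valP xi).
have [phi phiE] := choice phi_ex.
have bPsi z : boundary K (Psi (Ideal z)).
  apply/(visual_diag_eq0 gK o); rewrite visE PsiK; apply/(visual_diag_eq0 gM o).
  exact: Ideal_boundary.
pose psi z : boundary K := exist _ (Psi (Ideal z)) (mem_set (bPsi z)).
exists phi, psi; split.
- pose C := [set p : boundary K * Z | pairing (Phi (\val p.1) : bordification Z) (Ideal p.2) = 0].
  apply: (@continuous_closed_graph _ _ C) => [|| xi | xi z].
  + exact: apt_compact.
  + apply: closed_eq_continuous; last by move=> p; exact: cvg_cst.
    have cval : continuous (Phi \o \val : boundary K -> KM).
      move=> xi; apply: continuous_comp; first exact: boundary_val_continuous.
      exact: cPhi.
    exact: (@continuous_pair_comp (boundary K) (bordification Z) Z (bordification Z) R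
      (Phi \o \val) Ideal (fun p => pairing p.1 p.2) cval (@Ideal_continuous R Z)
      (@pairing_continuous R Z)).
  + by rewrite /C /= phiE; apply/pairing_Ideal2_eq0.
  + by rewrite /C /= phiE => /pairing_Ideal2_eq0.
- have cPI : continuous (Psi \o Ideal : Z -> K).
    by move=> z; apply: continuous_comp; [exact: Ideal_continuous | exact: cPsi].
  by apply: continuous_into_boundary; exact: cPI.
- by move=> xi; apply: val_inj; rewrite /= -phiE PhiK.
- by move=> z; have := phiE (psi z); rewrite /= PsiK => -[].
- move=> x xi eta; rewrite boundary_rhoE visE visual_moebius !phiE.
  exact: based_pairing_Ideal.
Qed.

Lemma filling_moebius : filling Z M.
Proof.
split=> [|K gK]; first exact: gromov_product_space_moebius.
have [phi [psi [cphi cpsi phiK psiK rhoE]]] := boundary_moebius gK.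
exists phi; split; first by split=> //; exists psi.
move=> x a b c d u.
rewrite (@mpt_equivalent _ _ x); first by rewrite /cross_ratio !rhoE.
by rewrite -(map_inj_uniq (can_inj phiK)) in u.
Qed.

(** The embedding sends [y] to [rho_y] transported to [Z]. Its extension to the
    compactifications relates [v] to [u] when, for base points that correspond,
    the products of [v] with points at infinity are those of [u] with their
    images by [f]. *)
Lemma maximal_moebius : maximal_gp_space M.
Proof.
split=> [|KX gKX Y [_ gY gcY _] KY gKY f [cf [g [cg fK gK]]] mf].
  exact: gromov_product_space_moebius.
have [phi [psi [cphi cpsi phiK psiK rhoE]]] := boundary_moebius gKX.
pose o := @basepoint R Z.
pose psiY z := g (psi z); pose phiY xi := phi (f xi).
have psiYK : cancel psiY phiY by move=> z; rewrite /psiY /phiY gK psiK.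
have phiYK : cancel phiY psiY by move=> xi; rewrite /psiY /phiY phiK fK.
have cpsiY : continuous psiY by move=> z; apply: continuous_comp; [exact: cpsi | exact: cg].
have FP y : antipodal (pullback psiY y).
  exact: (pullback_antipodal gKY gY gcY cpsiY psiYK phiYK).
have FE y : moebius_equivalent (apt_fun (a := Z)) (pullback psiY y).
  move=> a b c d u; rewrite (mpt_equivalent o u).
  have uY : uniq [:: psiY a; psiY b; psiY c; psiY d].
    by rewrite -(map_inj_uniq (can_inj psiYK)) in u.
  have := mf y o _ _ _ _ uY; rewrite /cross_ratio !rhoE /psiY !gK !psiK.
  by [].
pose F y : M := MoebiusPoint (FP y) (FE y).
have Fpull y : mpt_fun (F y) = pullback psiY y by [].
have dF y y' : mdist (F y) (F y') = mdist y y'.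
  exact: (mdist_pullback gKY gY gcY cpsiY phiYK).
exists F => //.
have [y0] : exists y : Y, True.
  apply: contrapT => nY; have [z _] := @apt_four _ Z.
  have [|v [_ [y _ _]]] := @cpt_dense _ KY setT _ openT; first by exists (\val (psiY z)).
  by apply: nY; exists y.
move=> _.
have rhoX (x : M) : mpt_fun x = pullback psi x.
  by apply/funext => a; apply/funext => b; rewrite /pullback rhoE !psiK.
(* [visual] at [emb y] is read off the derivative of [rho_y], which [F]
   transports *)
have visF y xi : visual (F y0) (cpt_emb KX (F y)) (\val (f xi)) =
    visual y0 (cpt_emb KY y) (\val xi).
  have := half_log_pullback gKX cpsi (phiY xi) (rhoX (F y0)) (rhoX (F y)).
  rewrite (half_log_pullback gKY cpsiY (phiY xi) (Fpull y0) (Fpull y)) dF.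
  rewrite phiYK /phiY phiK => /addIr/oppr_inj E.
  rewrite (visual_sym gKX) (visual_sym gKY); apply/esym/ln_inj; last exact: E.
    by rewrite posrE; exact: (visual_emb_gt0 gKY).
  by rewrite posrE; exact: (visual_emb_gt0 gKX).
have visf xi eta : visual (F y0) (\val (f xi)) (\val (f eta)) =
    visual y0 (\val xi) (\val eta).
  transitivity (boundary_rho (F y0) (f xi) (f eta)); first by [].
  rewrite rhoE Fpull /pullback.
  by rewrite -!/(phiY _) !phiYK.
pose C := \bigcap_(xi in [set: boundary KY]) [set p : KY * KX |
  visual y0 p.1 (\val xi) = visual (F y0) p.2 (\val (f xi))].
have cC : closed C.
  apply: closed_bigI => xi _; apply: closed_eq_continuous.
    exact: (@continuous_fst_comp KY KX _ _ (@visuall_continuous _ _ _ gKY y0 (\val xi))).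
  exact: (@continuous_snd_comp KY KX _ _
    (@visuall_continuous _ _ _ gKX (F y0) (\val (f xi)))).
(* both graphs, of [F] and of [f], are contained in the relation *)
have C_emb y : C (cpt_emb KY y, cpt_emb KX (F y)) by move=> xi _; rewrite /= visF.
have C_bd xi : C (\val xi, \val (f xi)) by move=> eta _; rewrite /= visf.
have C_unique v u w : C (v, u) -> C (v, w) -> u = w.
  move=> vu vw.
  apply: (boundary_separates gKX (@geodesic_moebius R Z)
    (@geodesically_complete_moebius R Z) (x := F y0)) => xi.
  rewrite -(gK xi); exact: etrans (esym (vu (g xi) I)) (vw (g xi) I).
have C_ex v : exists u, C (v, u).
  have [bv|/contrapT[y _ <-]] := pselect (boundary KY v); last by exists (cpt_emb KX (F y)).
  pose xi : boundary KY := exist _ v (mem_set bv).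
  by exists (\val (f xi)); have := C_bd xi.
have [h hE] := choice C_ex.
exists h; split.
- apply: (continuous_closed_graph (@cpt_compact _ KX) cC hE) => v u vu.
  exact: C_unique vu (hE v).
- by move=> y; exact: C_unique (hE _) (C_emb y).
- by move=> xi; exact: C_unique (hE _) (C_bd xi).
Qed.

End Filling.

Theorem theorem1p6 (R : realType) (Z : antipodalSpace R) :
  [/\ gromov_product_space (moebius_space Z),
      filling Z (moebius_space Z) &
      maximal_gp_space (moebius_space Z)].
Proof.
split; [exact: gromov_product_space_moebius | exact: filling_moebius |
  exact: maximal_moebius].
Qed.
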